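(* Let $2\le s_0\le s_1$ and let $u$ be a $C^2$ function defined in $\mathcal F_{[s_0,s_1]}\subset\mathbb R^{1+2}$ which decreases sufficiently fast at spatial infinity. Then $$\mathbf E_{con}(s_1,u)^{1/2}\le \mathbf E_{con}(s_0,u)^{1/2}+\frac{\sqrt2}{2}\int_{s_0}^{s_1}\big\|J\,\zeta^{-1}A^{1/2}\,\Box u\big\|_{L^2(\mathcal F_\tau)}\,d\tau .$$
   Context: Work in $\mathbb R^{1+2}$ with coordinates $(t,x)=(t,x^1,x^2)$, $r=|x|$, $\partial_a=\partial/\partial x^a$, Latin indices summed over $\{1,2\}$, $\Box=\partial_t^2-\partial_1^2-\partial_2^2$, $\partial_ru=(x^a/r)\partial_au$. Fix a smooth $\chi:\mathbb R\to\mathbb R$ with $\chi=1$ on $[1,\infty)$, $\chi=0$ on $(-\infty,0]$ and, on $(0,1)$, $\chi'>0$ and $|\chi'|+|\chi''|\le C\chi^{1/2}$. For $s\ge2$ put $\rho^{\mathcal H}(s)=(s^2-1)/2$, $\xi(s,r)=1-\chi(r-\rho^{\mathcal H}(s))$, and let $T(s,\cdot)$ solve $\partial_rT(s,r)=\xi(s,r)r(s^2+r^2)^{-1/2}$, $T(s,0)=s$. Set $\mathcal F_s=\{(t,x):t=T(s,|x|)\}$ and $\mathcal F_{[s_0,s_1]}=\{(t,x):T(s_0,|x|)\le t\le T(s_1,|x|)\}$; through $t=T(s,r)$, $s$ is regarded as a function of $(t,x)$. Norms and integrals on $\mathcal F_s$ are with respect to $dx$: $\|f\|_{L^2(\mathcal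 F_s)}^2=\int_{\mathbb R^2}|f(T(s,|x|),x)|^2dx$. Put $J=\partial_sT(s,r)$, $$\zeta=\Big(1-\frac{\xi(s,r)^2r^2}{s^2+r^2}\Big)^{1/2},\qquad A=t^2+r^2-\frac{2\xi(s,r)\,t\,r^2}{(s^2+r^2)^{1/2}}.$$ The conformal energy is $\mathbf E_{con}(s,u)=\int_{\mathcal F_s}\mathbf e_{con}[u]\,dx$ with $$\mathbf e_{con}[u]=\tfrac12\Big(t^2+r^2+\tfrac{2\xi tr^2}{(s^2+r^2)^{1/2}}\Big)|\partial_tu|^2+\tfrac12\Big(t^2+r^2-\tfrac{2\xi tr^2}{(s^2+r^2)^{1/2}}\Big)\sum_a|\partial_au|^2+\Big(2tx^a+\tfrac{\xi(t^2+r^2)x^a}{(s^2+r^2)^{1/2}}\Big)\partial_tu\,\partial_au+\tfrac{2t\xi|r\partial_ru|^2}{(s^2+r^2)^{1/2}}+tu\Big(\partial_t+\tfrac{\xi x^a}{(s^2+r^2)^{1/2}}\partial_a\Big)u-\tfrac12u^2 .$$ ''Decreases sufficiently fast at spatial infinity'': $u$ and its derivatives up to order two are $O(\langle x\rangle^{-m})$ in the region, for a sufficiently large $m$, so that all integrals converge and boundary terms at infinity vanish. *)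

(* Defs.v *)
From HB Require Import structures.
From mathcomp Require Export all_boot all_order all_algebra.
From mathcomp Require Export all_classical all_reals all_analysis.

Set Implicit Arguments.
Unset Strict Implicit.
Unset Printing Implicit Defensive.

Import Order.TTheory GRing.Theory Num.Theory.
Import numFieldNormedType.Exports.

Local Open Scope classical_set_scope.
Local Open Scope ring_scope.

(* A point of R^{1+2} is (t, (x^1, x^2)). *)
Definition spacetime (R : realType) : normedModType R := (R * (R * R))%type.

Section Foliation.
Variable R : realType.
Implicit Types (chi : R -> R) (T : R -> R -> R) (s r : R) (x : R * R).

Definition smooth (f : R -> R) : Prop :=
  forall (n : nat) (y : R), derivable (f^`(n)%classic) y 1.

Definition cutoff chi : Prop :=
  [/\ smooth chi,
      forall y, 1 <= y -> chi y = 1,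
      forall y, y <= 0 -> chi y = 0,
      forall y, 0 < y < 1 -> 0 < (chi^`()%classic) y &
      exists C : R, forall y, 0 < y < 1 ->
        `|(chi^`()%classic) y| + `|(chi^`(2)%classic) y|
          <= C * Num.sqrt (chi y)].

Definition rhoH s : R := (s ^+ 2 - 1) / 2.

Definition xi chi s r : R := 1 - chi (r - rhoH s).

(* The equation is imposed on r >= 0 and s >= 2 only. Continuity up to r = 0
   makes it hold there with the one-sided derivative. *)
Definition time_function chi T : Prop :=
  forall s, 2 <= s ->
    [/\ T s 0 = s,
        {within `[0, +oo[, continuous (T s)} &
        forall r, 0 < r ->
          is_derive r 1 (T s) (xi chi s r * r / Num.sqrt (s ^+ 2 + r ^+ 2))].

Definition radius x : R := Num.sqrt (x.1 ^+ 2 + x.2 ^+ 2).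

Definition japanese x : R := Num.sqrt (1 + radius x ^+ 2).

(* The point of F_s above x. *)
Definition slice T s x : spacetime R := (T s (radius x), x).

(* F_[s0, s1] *)
Definition slab T s0 s1 : set (spacetime R) :=
  [set p | T s0 (radius p.2) <= p.1 <= T s1 (radius p.2)].

(* T is constrained only for s >= 2, so this is meaningless at the single value
   s = 2, which does not affect integrals in s. *)
Definition jac T s r : R := ((T^~ r)^`()%classic) s.

Definition zeta chi s r : R :=
  Num.sqrt (1 - xi chi s r ^+ 2 * r ^+ 2 / (s ^+ 2 + r ^+ 2)).

Definition coefA chi s (t r : R) : R :=
  t ^+ 2 + r ^+ 2 - 2 * xi chi s r * t * r ^+ 2 / Num.sqrt (s ^+ 2 + r ^+ 2).

End Foliation.

Section Energy.
Variable R : realType.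
Implicit Types (chi : R -> R) (T : R -> R -> R) (s t : R) (x : R * R).
Implicit Types (u : spacetime R -> R) (p : spacetime R).

(* Coordinate vectors in the order t, x^1, x^2. *)
Definition dir (i : 'I_3) : spacetime R :=
  ((i == 0 :> nat)%:R, ((i == 1 :> nat)%:R, (i == 2 :> nat)%:R)).

Definition partial (i : 'I_3) u : spacetime R -> R := fun p => 'D_(dir i) u p.

Definition box u p : R :=
  partial 0 (partial 0 u) p - partial 1 (partial 1 u) p
    - partial 2%:R (partial 2%:R u) p.

Definition C2_on (U : set (spacetime R)) u : Prop :=
  [/\ {in U, continuous u},
      forall i p, U p -> derivable u p (dir i),
      forall i, {in U, continuous (partial i u)},
      forall i j p, U p -> derivable (partial i u) p (dir j) &
      forall i j, {in U, continuous (partial j (partial i u))}].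

(* C^2 on a set that need not be open: C^2 on an open neighbourhood of it. Only
   the values of u on that neighbourhood matter. *)
Definition C2_around (D : set (spacetime R)) u : Prop :=
  exists U, [/\ open U, D `<=` U & C2_on U u].

Definition decays (m : nat) (D : set (spacetime R)) u : Prop :=
  exists C : R, forall p, D p ->
    [/\ `|u p| <= C * japanese p.2 ^- m,
        forall i, `|partial i u p| <= C * japanese p.2 ^- m &
        forall i j, `|partial j (partial i u) p| <= C * japanese p.2 ^- m].

(* Since 0^-1 = 0, this is 0 at r = 0; it only occurs multiplied by r. *)
Definition partial_r u p : R :=
  p.2.1 / radius p.2 * partial 1 u p + p.2.2 / radius p.2 * partial 2%:R u p.

(* The energy density at a point p of F_s, i.e. with s = s(p). *)
Definition econ chi s u p : R :=
  let t := p.1 in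
  let x1 := p.2.1 in
  let x2 := p.2.2 in
  let r := radius p.2 in
  let b := xi chi s r / Num.sqrt (s ^+ 2 + r ^+ 2) in
  let ut := partial 0 u p in
  let u1 := partial 1 u p in
  let u2 := partial 2%:R u p in
  2^-1 * (t ^+ 2 + r ^+ 2 + 2 * b * t * r ^+ 2) * ut ^+ 2
  + 2^-1 * (t ^+ 2 + r ^+ 2 - 2 * b * t * r ^+ 2) * (u1 ^+ 2 + u2 ^+ 2)
  + ((2 * t * x1 + b * (t ^+ 2 + r ^+ 2) * x1) * ut * u1
     + (2 * t * x2 + b * (t ^+ 2 + r ^+ 2) * x2) * ut * u2)
  + 2 * t * b * (r * partial_r u p) ^+ 2
  + t * u p * (ut + b * (x1 * u1 + x2 * u2))
  - 2^-1 * u p ^+ 2.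

Local Notation leb2 := (@lebesgue_measure R \x @lebesgue_measure R)%E.

Definition Econ chi T s u : \bar R :=
  (\int[leb2]_x (econ chi s u (slice T s x))%:E)%E.

Definition L2slice T s (f : spacetime R -> R) : \bar R :=
  ('N[leb2]_(2%:E)[EFin \o f \o slice T s])%E.

(* J zeta^-1 A^(1/2) Box u at a point p of F_s. *)
Definition source chi T s u p : R :=
  let r := radius p.2 in
  jac T s r * (zeta chi s r)^-1 * Num.sqrt (coefA chi s p.1 r) * box u p.

End Energy.

(* Main.v *)
(** Contract the wave equation with the conformal multiplier
    [S u = (t^2 + r^2) u_t + 2 t x^a u_a + t u]. Pulled back to the coordinates
    [(s, x)] the resulting conservation law reads
    [d/ds e_con = J (S u) (Box u) - d_a (J V_a)], so that
    [E' = int J (S u) (Box u) dx]. The energy density is not pointwise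
    nonnegative, but it becomes so after adding the tangential divergence of
    [x u^2 / 2], which integrates to zero; the corrected density moreover
    dominates [zeta^2 (S u)^2 / (2 A)]. Cauchy-Schwarz then bounds [E'] by
    [sqrt 2 E^(1/2)] times the norm of [J zeta^-1 A^(1/2) Box u], and one
    integrates [(E^(1/2))'].

    The time function is handled through [w = r^2]: as [xi r dr = xi dw / 2],
    [T(s, |x|)] is a differentiable function of [x] also at the origin. *)
Require Import Defs.
From mathcomp Require Import measurable_realfun ring lra.
Import Order.TTheory GRing.Theory Num.Theory.
Import numFieldNormedType.Exports.
Local Open Scope classical_set_scope.
Local Open Scope ring_scope.

Set Implicit Arguments.
Unset Strict Implicit.
Unset Printing Implicit Defensive.

(** * Mean values, symmetry of second derivatives and the chain rule *)

(** Nothing is assumed about how [T] depends on [s], and [T] is unconstrained for s < 2. It is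
    therefore replaced by an explicit formula [Th] on a domain in which both s = 2 and the origin
    are interior; existence and positivity of J are read off from that formula. No divergence
    theorem on the region between two leaves is used: at fixed x the density is differentiated in s
    under the integral sign, and a tangential divergence integrates to zero by Fubini and the
    one-dimensional fundamental theorem of calculus. The regularity of u is given through its
    partial derivatives only, so the chain rule along the leaves and the symmetry of second
    derivatives are derived from mean values. The analytic side conditions become a bookkeeping of
    orders of growth in <x>; crude bounds on t, J and 1 / zeta^2 suffice, because fields of order
    -10 absorb every polynomial weight that occurs. As E may vanish, its square root is reached as
    the limit of (E + e)^(1/2). *)

Lemma is_derive_cvg (R : realType) (F : R -> R) (y d : R) :
  h^-1 * (F (h + y) - F y) @[h --> 0^'] --> d -> is_derive y 1 F d.
Proof.
move=> c.
have E : (fun h : R => h^-1 *: (F (h *: 1 + y) - F y)) =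
         (fun h => h^-1 * (F (h + y) - F y)).
  by apply/funext => h; rewrite [h *: 1]mulr1.
apply: DeriveDef; first by rewrite /derivable E; apply/cvg_ex; exists d.
by rewrite /derive E; apply: cvg_lim.
Qed.

Lemma dist_half (R : realFieldType) (x y z e : R) :
  `|x - z| < e / 2 -> `|y - z| < e / 2 -> `|x - y| <= e.
Proof. by have := ler_distD z x y; rewrite (distrC z y); lra. Qed.

Section directional.
Variables (R : realType) (V : normedModType R).
Implicit Types (f : V -> R) (p v w : V).

Lemma is_derive_line f p v (c : R) :
  derivable f (p + c *: v) v ->
  is_derive c 1 (fun h : R => f (p + h *: v)) ('D_v f (p + c *: v)).
Proof.
move=> df.
have E : (fun h : R => h^-1 *: (f (p + (h *: 1 + c) *: v) - f (p + c *: v)))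
       = (fun h : R => h^-1 *: (f (h *: v + (p + c *: v)) - f (p + c *: v))).
  by apply/funext => h; rewrite scalerDl [h *: 1]mulr1 addrCA.
apply: DeriveDef; first by rewrite /derivable /= E.
by rewrite /derive /= E.
Qed.

Lemma derivable_shift f p v w :
  derivable f (p + w) v -> derivable (fun q => f (q + w)) p v.
Proof. by rewrite /derivable /=; under eq_fun do rewrite addrA. Qed.

Lemma derive_shift f p v w : 'D_v (fun q => f (q + w)) p = 'D_v f (p + w).
Proof. by rewrite /derive /=; under eq_fun do rewrite -addrA. Qed.

Lemma mean_value_dir f p v (h : R) :
  (forall c : R, `|c| <= `|h| -> derivable f (p + c *: v) v) ->
  exists2 c : R, `|c| <= `|h| & f (p + h *: v) - f p = h * 'D_v f (p + c *: v).
Proof.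
move=> df.
have D (c : R) : `|c| <= `|h| ->
    is_derive c 1 (fun h : R => f (p + h *: v)) ('D_v f (p + c *: v)).
  by move=> ch; apply/is_derive_line/df.
have cont (a b : R) : (forall c, c \in `[a, b] -> `|c| <= `|h|) ->
    {within `[a, b], continuous (fun h : R => f (p + h *: v))}.
  move=> ab; apply: derivable_within_continuous => c cab.
  by have [] := D c (ab c cab).
have [h0|h0|h0] := ltgtP h 0.
- have ab (c : R) : c \in `[h, 0] -> `|c| <= `|h|.
    rewrite in_itv /= => /andP[hc c0].
    by rewrite (ler0_norm c0) (ltr0_norm h0) lerN2.
  have abo (c : R) : c \in `]h, 0[ -> `|c| <= `|h| by move/subset_itv_oo_cc/ab.
  have [c chc] := MVT h0 (fun c ci => D c (abo c ci)) (cont _ _ ab).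
  rewrite scale0r addr0 sub0r mulrN => E; exists c; first exact: abo.
  by rewrite -(opprB (f p)) E opprK mulrC.
- have ab (c : R) : c \in `[0, h] -> `|c| <= `|h|.
    rewrite in_itv /= => /andP[c0 ch].
    by rewrite (ger0_norm c0) (gtr0_norm h0).
  have abo (c : R) : c \in `]0, h[ -> `|c| <= `|h| by move/subset_itv_oo_cc/ab.
  have [c chc] := MVT h0 (fun c ci => D c (abo c ci)) (cont _ _ ab).
  rewrite scale0r addr0 subr0 => E; exists c; first exact: abo.
  by rewrite E mulrC.
- by exists 0; rewrite ?normr0 // h0 scale0r addr0 subrr mul0r.
Qed.

Let second_difference f v w (U : set V) p (h : R) :
  (forall c d : R, `|c| <= `|h| -> `|d| <= `|h| -> U (p + c *: v + d *: w)) ->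
  (forall q, U q -> derivable f q v) ->
  (forall q, U q -> derivable ('D_v f) q w) ->
  exists c d : R, [/\ `|c| <= `|h|, `|d| <= `|h| &
    f (p + h *: v + h *: w) - f (p + h *: v) - f (p + h *: w) + f p =
    h * (h * 'D_w ('D_v f) (p + c *: v + d *: w))].
Proof.
move=> Uh fv fvw.
pose g q := f (q + h *: w) - f q.
have z0 : `|0 : R| <= `|h| by rewrite normr0.
have d1 c : `|c| <= `|h| -> derivable (fun q => f (q + h *: w)) (p + c *: v) v.
  by move=> ch; apply/derivable_shift/fv/Uh.
have d2 c : `|c| <= `|h| -> derivable f (p + c *: v) v.
  by move=> ch; apply: fv; have := Uh c 0 ch z0; rewrite scale0r addr0.
have [c ch E] : exists2 c : R, `|c| <= `|h| &
    g (p + h *: v) - g p = h * 'D_v g (p + c *: v).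
  by apply: mean_value_dir => c ch; apply: derivableB; [exact: d1|exact: d2].
have [d dh E'] : exists2 d : R, `|d| <= `|h| &
    'D_v f (p + c *: v + h *: w) - 'D_v f (p + c *: v) =
    h * 'D_w ('D_v f) (p + c *: v + d *: w).
  apply: (@mean_value_dir ('D_v f) (p + c *: v) w h) => d dh.
  exact/fvw/Uh.
exists c, d; split => //.
rewrite -E' -derive_shift -deriveB; [|exact: d1|exact: d2].
move: E; rewrite /g; set a := f (p + h *: v + h *: w).
set b := f (p + h *: v); set c' := f (p + h *: w); set d' := f p => <-.
by rewrite opprB addrA addrAC.
Qed.

(** The second difference over the parallelogram spanned by [h v] and [h w] is symmetric in [v] and
    [w], and two mean values turn it into h^2 times either mixed derivative at a nearby point.
    Continuity at [p] identifies the two. *)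
Lemma derive_sym f v w (U : set V) p : open U -> U p ->
  (forall q, U q -> derivable f q v) -> (forall q, U q -> derivable f q w) ->
  (forall q, U q -> derivable ('D_v f) q w) ->
  (forall q, U q -> derivable ('D_w f) q v) ->
  {for p, continuous ('D_w ('D_v f))} -> {for p, continuous ('D_v ('D_w f))} ->
  'D_w ('D_v f) p = 'D_v ('D_w f) p.
Proof.
move=> oU Up fv fw fvw fwv c1 c2.
apply/eqP; rewrite -subr_eq0 -normr_eq0 eq_le normr_ge0 andbT.
apply/ler_addgt0Pr => e e0; rewrite add0r.
have e2 : 0 < e / 2 by rewrite divr_gt0.
have /cvgrPdist_lt/(_ _ e2) n1 := c1.
have /cvgrPdist_lt/(_ _ e2) n2 := c2.
have n0 : nbhs p U by apply: open_nbhs_nbhs.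
have [r0 /= r00 rP0] := (nbhs_normP _ _).1 n0.
have [r1 /= r10 rP1] := (nbhs_normP _ _).1 n1.
have [r2 /= r20 rP2] := (nbhs_normP _ _).1 n2.
pose r := Num.min r0 (Num.min r1 r2).
have r_gt0 : 0 < r by rewrite !lt_min r00 r10 r20.
have rP q : `|p - q| < r -> [/\ U q, `|'D_w ('D_v f) p - 'D_w ('D_v f) q| < e / 2 &
    `|'D_v ('D_w f) p - 'D_v ('D_w f) q| < e / 2].
  rewrite !lt_min => /and3P[q0 q1 q2].
  by split; [exact: rP0|exact: rP1|exact: rP2].
(* Puts the whole parallelogram inside the ball of radius [r]; the summand 1 covers v = w = 0. *)
pose h := r / (2 * (1 + `|v| + `|w|)).
have M0 : 0 < 1 + `|v| + `|w| by rewrite -addrA ltr_pwDl // addr_ge0.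
have h0 : 0 < h by rewrite divr_gt0 // mulr_gt0.
have small (c d : R) : `|c| <= `|h| -> `|d| <= `|h| ->
    `|p - (p + c *: v + d *: w)| < r.
  rewrite (gtr0_norm h0) => ch dh.
  rewrite -addrA opprD addNKr normrN (le_lt_trans (ler_normD _ _))// !normrZ.
  have -> : r = 2 * (h * (1 + `|v| + `|w|)).
    by rewrite /h; field; rewrite gt_eqF.
  have := ler_wpM2r (normr_ge0 v) ch; have := ler_wpM2r (normr_ge0 w) dh.
  have := normr_ge0 v; have := normr_ge0 w; nra.
have small' (c d : R) : `|c| <= `|h| -> `|d| <= `|h| ->
    `|p - (p + c *: w + d *: v)| < r.
  by move=> ch' dh'; rewrite addrAC; apply: small.
have [c [d [ch dh E]]] := @second_difference f v w U p h
  (fun c d ch dh => let: And3 a _ _ := rP _ (small c d ch dh) in a) fv fvw.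
have [c' [d' [ch' dh' E']]] := @second_difference f w v U p h
  (fun c d ch dh => let: And3 a _ _ := rP _ (small' c d ch dh) in a) fw fwv.
have [_ A1 _] := rP _ (small c d ch dh).
have [_ _ A2] := rP _ (small' c' d' ch' dh').
have EE : 'D_w ('D_v f) (p + c *: v + d *: w) =
          'D_v ('D_w f) (p + c' *: w + d' *: v).
  apply: (mulfI (lt0r_neq0 h0)); apply: (mulfI (lt0r_neq0 h0)).
  apply: etrans (esym E) _; apply: etrans _ E'.
  have -> : p + h *: w + h *: v = p + h *: v + h *: w by rewrite addrAC.
  by congr (_ + _); exact: addrAC.
rewrite -EE in A2; move: A1 A2; set x := 'D_w _ p; set y := 'D_v _ p.
set z := 'D_w _ _ => A1 A2.
exact: dist_half A1 A2.
Qed.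
End directional.

(** * Chain rule along curves from continuous partial derivatives *)

Section chain_rule.
Variable R : realType.
Implicit Types (f : spacetime R -> R) (p q : spacetime R).

(** Coordinates are changed one at a time; the norm is the maximum norm, so the intermediate points
    are no farther from [p] than [q] is. The bound on [Q] is unconditional so that [Q] can be chosen
    as a total function of [q] that tends to [p]. *)
Lemma increment_partials f p (r : R) :
  (forall q i, `|q - p| < r -> derivable f q (@dir R i)) ->
  forall q, exists Q : 'I_3 -> spacetime R,
    (forall i, `|Q i - p| <= `|q - p|) /\
    (`|q - p| < r -> f q - f p =
      (q.1 - p.1) * partial 0 f (Q 0) + (q.2.1 - p.2.1) * partial 1 f (Q 1)
      + (q.2.2 - p.2.2) * partial 2%:R f (Q 2%:R)).
Proof.
move=> df q.
have [qr|qr] := ltP `|q - p| r; last first.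
  by exists (fun=> q); split => // /lt_le_trans/(_ qr); rewrite ltxx.
have E0 (x : spacetime R) (c : R) : x + c *: @dir R 0 = (x.1 + c, x.2).
  case: x => a [b d]; apply: (f_equal2 pair); [|apply: (f_equal2 pair)] => /=.
  - by rewrite [c *: _]mulr1.
  - by rewrite [c *: _]mulr0 addr0.
  - by rewrite [c *: _]mulr0 addr0.
have E1 (x : spacetime R) (c : R) : x + c *: @dir R 1 = (x.1, (x.2.1 + c, x.2.2)).
  case: x => a [b d]; apply: (f_equal2 pair); [|apply: (f_equal2 pair)] => /=.
  - by rewrite [c *: _]mulr0 addr0.
  - by rewrite [c *: _]mulr1.
  - by rewrite [c *: _]mulr0 addr0.
have E2 (x : spacetime R) (c : R) : x + c *: @dir R 2%:R = (x.1, (x.2.1, x.2.2 + c)).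
  case: x => a [b d]; apply: (f_equal2 pair); [|apply: (f_equal2 pair)] => /=.
  - by rewrite [c *: _]mulr0 addr0.
  - by rewrite [c *: _]mulr0 addr0.
  - by rewrite [c *: _]mulr1.
have N (a b c : R) : `|a| <= `|q.1 - p.1| -> `|b| <= `|q.2.1 - p.2.1| ->
    `|c| <= `|q.2.2 - p.2.2| ->
    `|((p.1 + a, (p.2.1 + b, p.2.2 + c)) : spacetime R) - p| <= `|q - p|.
  move=> ha hb hc.
  have -> : `|q - p| = Num.max `|q.1 - p.1|
      (Num.max `|q.2.1 - p.2.1| `|q.2.2 - p.2.2|) by [].
  have -> : `|((p.1 + a, (p.2.1 + b, p.2.2 + c)) : spacetime R) - p| =
      Num.max `|p.1 + a - p.1|
        (Num.max `|p.2.1 + b - p.2.1| `|p.2.2 + c - p.2.2|) by [].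
  rewrite !ge_max; apply/and3P; split.
  - by rewrite addrAC subrr add0r le_max ha.
  - by rewrite addrAC subrr add0r !le_max hb orbT.
  - by rewrite addrAC subrr add0r !le_max hc !orbT.
have z (a : R) : `|0 : R| <= `|a| by rewrite normr0.
have [c0 h0 F0] : exists2 c : R, `|c| <= `|q.1 - p.1| &
    f (p + (q.1 - p.1) *: @dir R 0) - f p
    = (q.1 - p.1) * 'D_(@dir R 0) f (p + c *: @dir R 0).
  apply: mean_value_dir => c hc; apply: df; apply: le_lt_trans qr.
  have := N c 0 0 hc (z _) (z _); rewrite E0 !addr0.
  by rewrite -surjective_pairing.
pose P1 : spacetime R := (q.1, p.2).
have [c1 h1 F1] : exists2 c : R, `|c| <= `|q.2.1 - p.2.1| &
    f (P1 + (q.2.1 - p.2.1) *: @dir R 1) - f P1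
    = (q.2.1 - p.2.1) * 'D_(@dir R 1) f (P1 + c *: @dir R 1).
  apply: mean_value_dir => c hc; apply: df; apply: le_lt_trans qr.
  by have := N _ c 0 (lexx _) hc (z _); rewrite E1 addr0 subrKC.
pose P2 : spacetime R := (q.1, (q.2.1, p.2.2)).
have [c2 h2 F2] : exists2 c : R, `|c| <= `|q.2.2 - p.2.2| &
    f (P2 + (q.2.2 - p.2.2) *: @dir R 2%:R) - f P2
    = (q.2.2 - p.2.2) * 'D_(@dir R 2%:R) f (P2 + c *: @dir R 2%:R).
  apply: mean_value_dir => c hc; apply: df; apply: le_lt_trans qr.
  by have := N _ _ c (lexx _) (lexx _) hc; rewrite E2 !subrKC.
exists (fun i => if i == 0 then p + c0 *: @dir R 0
  else if i == 1 then P1 + c1 *: @dir R 1 else P2 + c2 *: @dir R 2%:R).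
split=> [i|_].
  case: ifP => _; [|case: ifP => _].
  - have := N c0 0 0 h0 (z _) (z _); rewrite E0 !addr0.
    by rewrite -surjective_pairing.
  - by have := N _ c1 0 (lexx _) h1 (z _); rewrite E1 addr0 subrKC.
  - by have := N _ _ c2 (lexx _) (lexx _) h2; rewrite E2 !subrKC.
rewrite /partial /= -F0 -F1 -F2 E0 E1 E2 /P1 /P2 /= !subrKC.
rewrite -!surjective_pairing.
set a := f q; set b := f (_, (_, _)); set c := f (_, _); set d := f p.
by lra.
Qed.

(** Mean values stand in for Frechet differentiability: the difference quotient is a sum of partial
    derivatives at points tending to [g y], each times the difference quotient of one component. *)
Lemma is_derive_curve f (U : set (spacetime R)) (g0 g1 g2 : R -> R)
    (y d0 d1 d2 : R) :
  open U -> U (g0 y, (g1 y, g2 y)) ->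
  (forall i p, U p -> derivable f p (@dir R i)) ->
  (forall i, {in U, continuous (partial i f)}) ->
  is_derive y 1 g0 d0 -> is_derive y 1 g1 d1 -> is_derive y 1 g2 d2 ->
  is_derive y 1 (fun h => f (g0 h, (g1 h, g2 h)))
    (partial 0 f (g0 y, (g1 y, g2 y)) * d0 +
     partial 1 f (g0 y, (g1 y, g2 y)) * d1 +
     partial 2%:R f (g0 y, (g1 y, g2 y)) * d2).
Proof.
move=> oU Up df cf D0 D1 D2.
pose g h : spacetime R := (g0 h, (g1 h, g2 h)).
rewrite -/(g y) in Up *.
case: (D0) (D1) (D2) => [dg0 v0] [dg1 v1] [dg2 v2].
have cont (k : R -> R) : derivable k y 1 -> {for y, continuous k}.
  by move=> /derivable1_diffP/differentiable_continuous.
have cg : {for y, continuous g}.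
  apply: (@cvg_pair _ _ _ _ (nbhs (g0 y)) (nbhs (g1 y, g2 y))).
    exact: (cont _ dg0).
  apply: (@cvg_pair _ _ _ _ (nbhs (g1 y)) (nbhs (g2 y))).
    exact: (cont _ dg1).
  exact: (cont _ dg2).
have /nbhs_normP[r /= r0 rP] : nbhs (g y) U by apply: open_nbhs_nbhs.
have inc := @increment_partials f (g y) r
  (fun q i h => df i q (rP q (eq_ind _ (fun z => is_true (z < r)) h _ (distrC _ _)))).
have [Q QP] := choice inc.
have cQ i : Q q i @[q --> g y] --> g y.
  apply/cvgrPdist_lt => e e0; near=> q.
  rewrite distrC (le_lt_trans ((QP q).1 i)) // distrC; near: q.
  have cg' : g (h + y) @[h --> 0^'] --> g y.
  have hy : h + y @[h --> 0^'] --> 0 + y.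
    by apply: cvgD; [exact: nbhs_dnbhs|exact: cvg_cst].
  by rewrite add0r in hy; exact: (cvg_comp _ _ hy cg).
have cA i : partial i f (Q (g (h + y)) i) @[h --> 0^'] --> partial i f (g y).
  apply: (cvg_comp _ _ (cvg_comp _ _ cg' (cQ i))).
  by apply: cf; rewrite inE.
have slope (k : R -> R) d : derivable k y 1 -> 'D_1 k y = d ->
    h^-1 * (k (h + y) - k y) @[h --> 0^'] --> d.
  move=> dk <-; move: dk; rewrite /derivable /derive /=.
  by under eq_fun do rewrite [_ *: 1]mulr1.
apply: is_derive_cvg.
have c i (k : R -> R) d : derivable k y 1 -> 'D_1 k y = d ->
    partial i f (Q (g (h + y)) i) * (h^-1 * (k (h + y) - k y)) @[h --> 0^']
    --> partial i f (g y) * d.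
  by move=> dk vk; apply: cvgM; [exact: cA|exact: slope].
apply: cvg_trans (cvgD (cvgD (c 0 _ _ dg0 v0) (c 1 _ _ dg1 v1))
  (c 2%:R _ _ dg2 v2)).
apply: near_eq_cvg; near=> h.
have E : `|g (h + y) - g y| < r.
  rewrite distrC; near: h.
  by move/cvgrPdist_lt : cg' => /(_ r r0).
by rewrite -/(g (h + y)) -/(g y) ((QP _).2 E) !fctE /g /=; ring.
Unshelve. all: by end_near. Qed.
End chain_rule.

(** * Integrals over the plane *)

Section plane.
Variable R : realType.
Local Notation leb := (@lebesgue_measure R).
Local Notation leb2 := (@lebesgue_measure R \x @lebesgue_measure R)%E.
Local Notation R2 := (measurableTypeR R * measurableTypeR R)%type.

(** Integrals over the plane refer to the product sigma-algebra; an open set belongs to it as the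
    union of the countably many rational squares that it contains. *)
Lemma open_prod_measurable (O : set (R * R)) :
  open O -> measurable (O : set R2).
Proof.
move=> oO.
pose B (a b q : rat) : set R2 := ball (ratr a : R) (ratr q) `*` ball (ratr b : R) (ratr q).
pose F a b q : set R2 := if `[< B a b q `<=` O >] then B a b q else set0.
have -> : (O : set R2) = \bigcup_a \bigcup_b \bigcup_q F a b q.
  apply/seteqP; split => [[x y] Oxy|x [a _ [b _ [q _]]]]; last first.
    by rewrite /F; case: asboolP => // BO /BO.
  have /nbhs_ballP[e /= e0 eO] : nbhs (x, y) O by apply: open_nbhs_nbhs.
  have appr (c d : R) : c < d -> exists q : rat, c < ratr q < d.
    move=> cd; have [|z [/= zcd [q _ qz]]] := @dense_rat R `]c, d[%classic _
      (@interval_open _ (BRight c) (BLeft d) isT isT).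
      by exists ((c + d) / 2); rewrite /= in_itv /= !midf_lt.
    by exists q; rewrite qz; move: zcd; rewrite in_itv.
  (* A square of half-side below e / 2 that contains the point stays within [e] of it. *)
  have [q /andP[q0 qe]] := appr 0 (e / 2) ltac:(lra).
  have [a /andP[a1 a2]] := appr (x - ratr q) (x + ratr q) ltac:(lra).
  have [b /andP[b1 b2]] := appr (y - ratr q) (y + ratr q) ltac:(lra).
  exists a => //; exists b => //; exists q => //.
  have BO : B a b q `<=` O.
    move=> [x' y'] [/=]; rewrite /ball /= /ball_ !ltr_norml => /andP[h1 h2] /andP[h3 h4].
    apply: eO; split; rewrite /= /ball /= /ball_ ltr_norml; lra.
  rewrite /F; case: asboolP => // _.
  by split; rewrite /= /ball /= /ball_ ltr_norml; lra.
apply: bigcupT_measurable_rat => a; apply: bigcupT_measurable_rat => b.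
apply: bigcupT_measurable_rat => q; rewrite /F; case: asboolP => // _.
by apply: measurableX; apply: open_measurable; exact: ball_open.
Qed.

Lemma continuous_prod_measurable (f : R * R -> R) :
  continuous f -> measurable_fun [set: R2] f.
Proof.
move=> /continuousP cf.
apply: (measurability _ (RGenOpens.measurableE R)).
move=> _ [_ [a [b ->] <-]]; rewrite setTI; apply: open_prod_measurable.
exact/cf/interval_open.
Qed.

Lemma oneDsqr_pos (x : R) : 0 < oneDsqr x.
Proof. exact: lt_le_trans ltr01 (oneDsqr_ge1 x). Qed.

(** A product, so that Tonelli reduces its integrability to that of 1 / (1 + x^2), and so that
    bounding one factor by 1 leaves an integrable majorant in the other variable. *)
Definition weight (x : R * R) : R := (oneDsqr x.1)^-1 * (oneDsqr x.2)^-1.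

Lemma weight_ge0 x : 0 <= weight x.
Proof. by rewrite mulr_ge0 // invr_ge0 ltW // oneDsqr_pos. Qed.

Lemma measurable_oneDsqrV :
  measurable_fun setT (fun x : measurableTypeR R => (oneDsqr x)^-1%:E).
Proof.
apply/measurable_EFinP; apply: continuous_measurable_fun.
exact: continuous_oneDsqrV.
Qed.

Lemma integral_oneDsqrV_lty : (\int[leb]_x (oneDsqr x)^-1%:E < +oo)%E.
Proof.
rewrite ge0_symfun_integralT; first last.
- by move=> x; rewrite /= /oneDsqr sqrrN.
- exact: continuous_oneDsqrV.
- by move=> x; rewrite invr_ge0 ltW // oneDsqr_pos.
by rewrite -set_itvcy integral0y_oneDsqr -EFinM ltry.
Qed.

Lemma continuous_weight : continuous weight.
Proof.
move=> x; apply: cvgM; (apply: (@cvg_comp _ _ _ _ (fun y => (oneDsqr y)^-1));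
  last exact: continuous_oneDsqrV).
- exact: cvg_fst.
- exact: cvg_snd.
Qed.

Lemma integrable_weight : leb2.-integrable [set: R2] (EFin \o weight).
Proof.
apply/integrable12ltyP.
  by apply/measurable_EFinP; exact: continuous_prod_measurable continuous_weight.
have I0 : (0 <= \int[leb]_x (oneDsqr x)^-1%:E)%E.
  by apply: integral_ge0 => x _; rewrite lee_fin invr_ge0 ltW // oneDsqr_pos.
have m1 := measurable_oneDsqrV.
have E x : (\int[leb]_y `|(EFin \o weight) (x, y)| =
    (oneDsqr x)^-1%:E * \int[leb]_y (oneDsqr y)^-1%:E)%E.
  rewrite -ge0_integralZl //.
  - by apply: eq_integral => y _; rewrite /= ger0_norm ?weight_ge0 // EFinM.
under eq_integral => x _ do rewrite E.
rewrite ge0_integralZr //.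
- by apply: lte_mul_pinfty => //; [rewrite ge0_fin_numE //|]; exact: integral_oneDsqrV_lty.
Qed.

Lemma integrable_bounded_weight (f : R * R -> R) (C : R) : continuous f ->
  (forall x, `|f x| <= C * weight x) -> leb2.-integrable [set: R2] (EFin \o f).
Proof.
move=> cf fC.
have : leb2.-integrable [set: R2] (fun x => (C%:E * (weight x)%:E)%E).
  by apply: integrableZl => //; exact: integrable_weight.
apply: le_integrable => //.
  by apply/measurable_EFinP; exact: continuous_prod_measurable.
by move=> x _ /=; rewrite lee_fin (le_trans (fC x)) // ler_norm.
Qed.

(** By dominated convergence the integral is the limit of those over growing symmetric intervals,
    and these are differences of boundary values of [F], which tend to 0. *)
Lemma integral_derive_decay (F f : R -> R) (C : R) : continuous f ->
  (forall x : R, is_derive x 1 F (f x)) ->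
  (forall x, `|f x| <= C * (oneDsqr x)^-1) ->
  (forall x, `|F x| <= C * (oneDsqr x)^-1) ->
  (\int[leb]_x (f x)%:E = 0)%E.
Proof.
move=> cf dF fC FC.
have C0 : 0 <= C.
  by have := le_trans (normr_ge0 _) (fC 0); rewrite pmulr_lge0 // invr_gt0 oneDsqr_pos.
have ig : leb.-integrable setT (fun x => (C%:E * (oneDsqr x)^-1%:E)%E).
  apply: integrableZl => //; apply/integrableP; split.
    exact: measurable_oneDsqrV.
  under eq_integral => x _ do rewrite /= ger0_norm ?invr_ge0 ?ltW ?oneDsqr_pos //.
  exact: integral_oneDsqrV_lty.
(* [n.+1] keeps the interval nondegenerate at n = 0, as the fundamental theorem of calculus
   requires. *)
pose I n : set R := `[- n.+1%:R, n.+1%:R]%classic.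
pose f_ n := (EFin \o f) \_ (I n).
have mf : measurable_fun setT (EFin \o f).
  by apply/measurable_EFinP; exact: continuous_measurable_fun.
have lim1 : (\int[leb]_x f_ n x)%E @[n --> \oo] --> (\int[leb]_x (f x)%:E)%E.
  apply: (dominated_cvg _ _ _ _ ig) => //.
  - move=> n; apply/(measurable_restrictT _ _).1.
      exact: measurable_itv.
    exact: measurable_funTS.
  - move=> x _; apply: cvg_near_cst; near=> n.
    rewrite /f_ patchE ifT // inE /I /= in_itv /= -ler_norml.
    rewrite (@le_trans _ _ n%:R) //; last by rewrite ler_nat.
    by near: n; exact: nbhs_infty_ger.
  - move=> n x _; rewrite /f_ patchE; case: ifP => _ /=.
      by rewrite lee_fin.
    by rewrite normr0 -EFinM lee_fin (le_trans (normr_ge0 _) (fC x)).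
have E n : (\int[leb]_x f_ n x = (F n.+1%:R - F (- n.+1%:R))%:E)%E.
  rewrite /f_ -integral_mkcond /I /= EFinB; apply: continuous_FTC2.
  - by rewrite gtrN // ltr0n.
  - exact: continuous_subspaceT.
  - have cF : continuous F.
      move=> x; apply: differentiable_continuous; apply/derivable1_diffP.
      by have [] := dF x.
    split => [x _|//|//]; first by have [] := dF x.
      by apply: cvg_at_right_filter; exact: cF.
    by apply: cvg_at_left_filter; exact: cF.
  - by move=> x _; rewrite derive1E; have [_ ->] := dF x.
have lim0 : (fun n => F n.+1%:R - F (- n.+1%:R)) @ \oo --> 0.
  apply: norm_cvg0.
  apply: (@squeeze_cvgr _ _ _ _ (cst 0) (fun n => C * 2 * harmonic n)); last 2 first.
  - exact: cvg_cst.
  - have := cvgM (cvg_cst (C * 2)) (@cvg_harmonic R); rewrite mulr0; exact.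
  apply: nearW => n; rewrite normr_ge0 /= (le_trans (ler_normB _ _)) //.
  have /(ler_wpM2l C0) W : (oneDsqr n.+1%:R)^-1 <= harmonic n :> R.
    rewrite /harmonic lef_pV2 ?posrE ?oneDsqr_pos ?ltr0n // /oneDsqr.
    have : (1 : R) <= n.+1%:R by rewrite ler1n.
    by nra.
  have h1 := FC n.+1%:R; have := FC (- n.+1%:R).
  have -> : oneDsqr (- n.+1%:R) = oneDsqr n.+1%:R :> R by rewrite /oneDsqr sqrrN.
  move=> h2; apply: le_trans (lerD h1 h2) _.
  rewrite (_ : C * 2 / _ = C * harmonic n + C * harmonic n); first exact: lerD.
  by rewrite -[RHS]mulr2n -[RHS]mulr_natr [RHS]mulrAC.
have E' : (fun n => \int[leb]_x f_ n x)%E =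
    (fun n => (F n.+1%:R - F (- n.+1%:R))%:E) by apply/funext.
rewrite E' in lim1.
have lim2 : (F n.+1%:R - F (- n.+1%:R))%:E @[n --> \oo] --> (0 : R)%:E.
  by apply: cvg_EFin => //; exact: nearW.
by rewrite -(cvg_lim _ lim1) // (cvg_lim _ lim2).
Unshelve. all: by end_near. Qed.

Lemma continuous_fst_section (f : R * R -> R) (y : R) :
  continuous f -> continuous (fun x => f (x, y)).
Proof.
move=> cf x.
have c : {for x, continuous (fun z : R => (z, y))}.
  apply: (@cvg_pair _ _ _ _ (nbhs x) (nbhs y)); first exact: cvg_id.
  exact: cvg_cst.
exact: (cvg_comp _ _ c (cf (x, y))).
Qed.

Lemma continuous_snd_section (f : R * R -> R) (x : R) :
  continuous f -> continuous (fun y => f (x, y)).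
Proof.
move=> cf y.
have c : {for y, continuous (fun z : R => (x, z))}.
  apply: (@cvg_pair _ _ _ _ (nbhs x) (nbhs y)); last exact: cvg_id.
  exact: cvg_cst.
exact: (cvg_comp _ _ c (cf (x, y))).
Qed.

(** Fubini with the differentiated variable innermost: the inner integral vanishes for every value
    of the other variable. *)
Lemma integral_plane_derive1 (F f : R * R -> R) (C : R) : continuous f ->
  (forall x y : R, is_derive x 1 (fun x' => F (x', y)) (f (x, y))) ->
  (forall x, `|f x| <= C * weight x) -> (forall x, `|F x| <= C * weight x) ->
  (\int[leb2]_x (f x)%:E = 0)%E.
Proof.
move=> cf dF fC FC.
rewrite -(integral21_prod_meas1 (integrable_bounded_weight cf fC)).
rewrite /fubini_G; apply: integral0_eq => y _.
have b0 (z : R) : 0 <= (oneDsqr z)^-1 <= 1.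
  rewrite invr_ge0 (ltW (oneDsqr_pos _)) /=.
  by rewrite invf_le1 ?oneDsqr_pos // /oneDsqr lerDl sqr_ge0.
have C0 : 0 <= C.
  have := le_trans (normr_ge0 _) (fC (0, 0)).
  by rewrite /weight pmulr_lge0 // mulr_gt0 // invr_gt0 oneDsqr_pos.
apply: (@integral_derive_decay (fun x => F (x, y)) _ C) => //=.
- exact: continuous_fst_section.
- move=> x; apply: le_trans (fC _) _; apply: ler_wpM2l => //.
  by rewrite /weight ler_piMr //=; case/andP: (b0 x); case/andP: (b0 y).
- move=> x; apply: le_trans (FC _) _; apply: ler_wpM2l => //.
  by rewrite /weight ler_piMr //=; case/andP: (b0 x); case/andP: (b0 y).
Qed.

Lemma integral_plane_derive2 (F f : R * R -> R) (C : R) : continuous f ->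
  (forall x y : R, is_derive y 1 (fun y' => F (x, y')) (f (x, y))) ->
  (forall x, `|f x| <= C * weight x) -> (forall x, `|F x| <= C * weight x) ->
  (\int[leb2]_x (f x)%:E = 0)%E.
Proof.
move=> cf dF fC FC.
rewrite -(integral12_prod_meas1 (integrable_bounded_weight cf fC)).
rewrite /fubini_F; apply: integral0_eq => x _.
have b0 (z : R) : 0 <= (oneDsqr z)^-1 <= 1.
  rewrite invr_ge0 (ltW (oneDsqr_pos _)) /=.
  by rewrite invf_le1 ?oneDsqr_pos // /oneDsqr lerDl sqr_ge0.
have C0 : 0 <= C.
  have := le_trans (normr_ge0 _) (fC (0, 0)).
  by rewrite /weight pmulr_lge0 // mulr_gt0 // invr_gt0 oneDsqr_pos.
apply: (@integral_derive_decay (fun y => F (x, y)) _ C) => //=.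
- exact: continuous_snd_section.
- move=> y; apply: le_trans (fC _) _; apply: ler_wpM2l => //.
  by rewrite /weight ler_piMl //=; case/andP: (b0 x); case/andP: (b0 y).
- move=> y; apply: le_trans (FC _) _; apply: ler_wpM2l => //.
  by rewrite /weight ler_piMl //=; case/andP: (b0 x); case/andP: (b0 y).
Qed.

End plane.

(** * The time function *)

Lemma is_derive_continuous (R : realType) (f : R -> R) (x d : R) :
  is_derive x 1 f d -> {for x, continuous f}.
Proof. by case=> /derivable1_diffP/differentiable_continuous. Qed.

Section pointwise_derivatives.
Variable R : realType.
Implicit Types (f g : R -> R) (x a b : R).

Lemma derive_ext f x a b : is_derive x 1 f a -> a = b -> is_derive x 1 f b.
Proof. by move=> + <-. Qed.

Lemma derive_cst_fun (c : R) x : is_derive x 1 (fun=> c) 0.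
Proof. exact: is_derive_cst. Qed.

Lemma derive_id_fun x : is_derive x 1 (fun y : R => y) 1.
Proof. exact: is_derive_id. Qed.

Lemma derive_add f g x a b : is_derive x 1 f a -> is_derive x 1 g b ->
  is_derive x 1 (fun y => f y + g y) (a + b).
Proof. by move=> df dg; apply: is_deriveD. Qed.

Lemma derive_opp f x a : is_derive x 1 f a -> is_derive x 1 (fun y => - f y) (- a).
Proof. by move=> df; apply: is_deriveN. Qed.

Lemma derive_mul f g x a b : is_derive x 1 f a -> is_derive x 1 g b ->
  is_derive x 1 (fun y => f y * g y) (f x * b + g x * a).
Proof. by move=> df dg; apply: is_deriveM. Qed.

Lemma derive_inv f x a : f x != 0 -> is_derive x 1 f a ->
  is_derive x 1 (fun y => (f y)^-1) (- (f x) ^- 2 * a).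
Proof. by move=> f0 df; apply: is_deriveV. Qed.

Lemma derive_exp f n x a : is_derive x 1 f a ->
  is_derive x 1 (fun y => f y ^+ n) (n%:R * f x ^+ n.-1 * a).
Proof.
move=> df; have H := is_deriveX n df.
have -> : (fun y => f y ^+ n) = f ^+ n by apply/funext => y; rewrite exprfctE.
notypeclasses refine (derive_ext H _).
by rewrite /GRing.scale /= mulr_natl.
Qed.

End pointwise_derivatives.

(** The rules build up the derivative as an existential, so that [derive_eq] leaves an algebraic
    identity with the expected value. The context is tried before the rules and supplies the
    derivatives of named functions and the nonvanishing of denominators. *)
Ltac derive_auto :=
  repeat first [ eassumption | notypeclasses refine (derive_cst_fun _ _)
    | notypeclasses refine (derive_id_fun _)
    | notypeclasses refine (derive_add _ _) | notypeclasses refine (derive_opp _)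
    | notypeclasses refine (derive_mul _ _)
    | notypeclasses refine (derive_inv _ _) | notypeclasses refine (derive_exp _ _) ].

Ltac derive_eq := notypeclasses refine (derive_ext _ _); [by derive_auto|cbv beta].

(** * Monotonicity and bounds of the cutoff *)

Section cutoff_function.
Variables (R : realType) (chi : R -> R).
Hypothesis cchi : cutoff chi.
Local Notation dchi := (chi^`()%classic).

Lemma cutoff_is_derive (y : R) : is_derive y 1 chi (dchi y).
Proof. by case: cchi => sm _ _ _ _; rewrite derive1E; apply/derivableP; have := sm 0%N y. Qed.

Lemma cutoff_derive_continuous : continuous dchi.
Proof.
move=> y; case: cchi => sm _ _ _ _.
by have /derivable1_diffP/differentiable_continuous := sm 1%N y; rewrite derive1n1.
Qed.

Lemma cutoff_derive_eq0 y : y < 0 \/ 1 < y -> dchi y = 0.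
Proof.
case: cchi => _ chi1 chi0 _ _ y01; rewrite derive1E.
have [y0|y1] := y01.
- rewrite -(derive_cst (0 : R) y (1 : R)); apply: near_eq_derive => //.
  by near=> z; apply: chi0; apply: ltW; near: z; exact: lt_nbhsl.
- rewrite -(derive_cst (1 : R) y (1 : R)); apply: near_eq_derive => //.
  by near=> z; apply: chi1; apply: ltW; near: z; exact: lt_nbhsr.
Unshelve. all: by end_near. Qed.

(** The sign is given on ]0, 1[ and the derivative vanishes outside [0, 1]; continuity carries the
    sign to the two endpoints. *)
Lemma cutoff_derive_ge0 y : 0 <= dchi y.
Proof.
case: (cchi) => _ _ _ chipos _.
have [|y01] := pselect (y < 0 \/ 1 < y).
  by move=> /cutoff_derive_eq0 ->.
have y0 : 0 <= y by rewrite leNgt; apply/negP => h; apply: y01; left.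
have y1 : y <= 1 by rewrite leNgt; apply/negP => h; apply: y01; right.
rewrite leNgt; apply/negP => dy.
have /cvgrPdist_lt/(_ (- dchi y)) := @cutoff_derive_continuous y.
rewrite oppr_gt0 => /(_ dy)/nbhs_normP[e /= e0 eP].
(* A shift by d / 2 < 1 / 2 towards the middle lands in ]0, 1[ even from an endpoint. *)
pose d := Num.min e 1 / 2.
have [d0 de d1] : [/\ 0 < d, d < e & d < 1].
  rewrite /d; have : 0 < Num.min e 1 by rewrite lt_min e0 ltr01.
  have : Num.min e 1 <= e by rewrite ge_min lexx.
  have : Num.min e 1 <= 1 by rewrite ge_min lexx orbT.
  by move=> *; split; lra.
have [z z01 yz] : exists2 z, 0 < z < 1 & `|y - z| < e.
  have [hy|hy] := ltP y (1 / 2).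
    by exists (y + d / 2); rewrite ?ltr_norml; lra.
  by exists (y - d / 2); rewrite ?ltr_norml; lra.
have := eP z yz; rewrite /= ltr_norml => /andP[h _].
by have := chipos z z01; lra.
Qed.

(** Monotonicity confines the cutoff between its two constant values. *)
Lemma cutoff_ge0_le1 y : 0 <= chi y <= 1.
Proof.
case: (cchi) => _ chi1 chi0 _ _.
have mono a b : a <= b -> chi a <= chi b.
  move=> ab.
  have [c _ E] := @MVT_segment _ chi dchi a b ab (fun x _ => cutoff_is_derive x)
    (continuous_subspaceT (fun x => is_derive_continuous (cutoff_is_derive x))).
  by rewrite -subr_ge0 E mulr_ge0 ?subr_ge0 // cutoff_derive_ge0.
apply/andP; split.
- by have [y0|/ltW y0] := leP y 0; [rewrite chi0|rewrite -(chi0 0) // mono].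
- by have [y1|/ltW y1] := leP 1 y; [rewrite chi1|rewrite -(chi1 1) // mono].
Qed.

Lemma cutoff_derive_bounded : exists2 M : R, 0 <= M & forall y : R, dchi y <= M.
Proof.
have [c _ cP] := @EVT_max _ dchi 0 1 ler01
  (continuous_subspaceT cutoff_derive_continuous).
exists (dchi c); first exact: cutoff_derive_ge0.
move=> y; have [|y01] := pselect (y < 0 \/ 1 < y).
  by move=> /cutoff_derive_eq0 ->; exact: cutoff_derive_ge0.
apply: cP; rewrite in_itv /=; apply/andP; split.
  by rewrite leNgt; apply/negP => h; apply: y01; left.
by rewrite leNgt; apply/negP => h; apply: y01; right.
Qed.

End cutoff_function.

Lemma is_derive_integral_left (R : realType) (f : R -> R) (w : R) : -1 < w ->
  (forall t, -1 <= t -> {for t, continuous f}) ->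
  is_derive w 1
    (fun y => \int[@lebesgue_measure R]_(t in `[-1, y]%classic) f t) (f w).
Proof.
move=> w1 cf.
(* One unit beyond [w], so that the derivative at [w] is two-sided. *)
have i : (@lebesgue_measure R).-integrable `[-1, w + 1] (EFin \o f).
  apply: continuous_compact_integrable; first exact: segment_compact.
  apply: continuous_in_subspaceT => t; rewrite inE /= in_itv /= => /andP[t1 _].
  exact: cf.
have w2 : w < w + 1 by rewrite ltrDl.
have [d E] := continuous_FTC1_closed w2 i w1 (cf w (ltW w1)).
by apply: DeriveDef; [exact: d|rewrite -derive1E; exact: E].
Qed.

(** * An explicit time function in the variable w = r^2 *)

Section foliation_time.
Variables (R : realType) (chi : R -> R).
Hypothesis cchi : cutoff chi.
Local Notation dchi := (chi^`()%classic).
Local Notation leb := (@lebesgue_measure R).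
Implicit Types s w t : R.

(** Here [w] stands for r^2 but is allowed down to -1, and [s] down to 3/2, so that derivatives at w
    = 0 and at s = 2 are two-sided. On this domain s^2 + w > 1. As [Num.sqrt] is 0 on negative
    numbers, [chiH] vanishes for w <= 0. *)
Definition hyp s w : R := Num.sqrt (s ^+ 2 + w).
Definition chiH s w : R := chi (Num.sqrt w - rhoH s).
Definition dchiH s w : R := dchi (Num.sqrt w - rhoH s).

Lemma hyp_ge1 s w : 3 / 2 < s -> -1 <= w -> 1 <= hyp s w.
Proof.
move=> s1 w1; rewrite -[leLHS]sqrtr1 ler_sqrt; nra.
Qed.

Lemma sqr_hyp s w : 3 / 2 < s -> -1 <= w -> hyp s w ^+ 2 = s ^+ 2 + w.
Proof. by move=> s1 w1; rewrite sqr_sqrtr; nra. Qed.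

Lemma is_derive_hyp_s s w : 3 / 2 < s -> -1 <= w ->
  is_derive s 1 (hyp ^~ w) (s / hyp s w).
Proof.
move=> s1 w1; have h1 := hyp_ge1 s1 w1.
have p : 0 < s ^+ 2 + w by nra.
have d1 : is_derive s 1 (fun s : R => s ^+ 2 + w) (2 * s).
  by derive_eq; ring.
have H := @is_derive1_comp R (@Num.sqrt R) (fun s => s ^+ 2 + w) s _ _
  (is_derive1_sqrt p) d1.
notypeclasses refine (derive_ext H _); rewrite -/(hyp s w).
by field; rewrite gt_eqF; lra.
Qed.

Lemma is_derive_hyp_w s w : 3 / 2 < s -> -1 <= w ->
  is_derive w 1 (hyp s) (2 * hyp s w)^-1.
Proof.
move=> s1 w1; have h1 := hyp_ge1 s1 w1.
have p : 0 < s ^+ 2 + w by nra.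
have d1 : is_derive w 1 (fun w : R => s ^+ 2 + w) 1.
  by derive_eq; ring.
have H := @is_derive1_comp R (@Num.sqrt R) (fun w => s ^+ 2 + w) w _ _
  (is_derive1_sqrt p) d1.
by notypeclasses refine (derive_ext H _); rewrite mulr1.
Qed.

Lemma is_derive_rhoH s : is_derive s 1 (@rhoH R) s.
Proof.
by rewrite /rhoH; derive_eq; rewrite /=; lra.
Qed.

Lemma is_derive_chiH s w : is_derive s 1 (chiH ^~ w) (- s * dchiH s w).
Proof.
have d1 : is_derive s 1 (fun s => Num.sqrt w - rhoH s) (- s).
  by have d := is_derive_rhoH s; derive_eq; ring.
have H := @is_derive1_comp R chi (fun s => Num.sqrt w - rhoH s) s _ _
  (cutoff_is_derive cchi (Num.sqrt w - rhoH s)) d1.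
by notypeclasses refine (derive_ext H _); rewrite mulrC.
Qed.

Lemma continuous_chiH_w s : continuous (chiH s).
Proof.
move=> w; apply: (@cvg_comp _ _ _ (fun w => Num.sqrt w - rhoH s) chi).
  by apply: cvgB; [exact: sqrt_continuous|exact: cvg_cst].
exact: is_derive_continuous (cutoff_is_derive cchi _).
Qed.

Lemma continuous_dchiH_w s : continuous (dchiH s).
Proof.
move=> w; apply: (@cvg_comp _ _ _ (fun w => Num.sqrt w - rhoH s) dchi).
  by apply: cvgB; [exact: sqrt_continuous|exact: cvg_cst].
exact: cutoff_derive_continuous.
Qed.

Lemma continuous_dchiH_s w : continuous (dchiH ^~ w).
Proof.
move=> s; apply: (@cvg_comp _ _ _ (fun s => Num.sqrt w - rhoH s) dchi).
  by apply: cvgB; [exact: cvg_cst|exact: is_derive_continuous (is_derive_rhoH s)].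
exact: cutoff_derive_continuous.
Qed.

(** With xi = 1 - chi, the required derivative [slope / 2] of T in [w] is that of [hyp] minus
    [kern / 2]. The prefix [d] marks derivatives in [s]. The root inside [chiH] is never
    differentiated in [w], since [kern] only enters through its integral. *)
Definition kern s w : R := chiH s w / hyp s w.
Definition dkern s w : R :=
  - (s * dchiH s w / hyp s w) - s * chiH s w / hyp s w ^+ 3.
Definition slope s w : R := (1 - chiH s w) / hyp s w.
Definition dslope s w : R :=
  s * dchiH s w / hyp s w - s * (1 - chiH s w) / hyp s w ^+ 3.
(** The hyperboloid t = (s^2 + r^2)^(1/2), corrected where the cutoff sets in. Starting the integral
    at -1 instead of 0 adds nothing, because [kern] vanishes in between, and makes w = 0
    interior. *)
Definition Th s w : R := hyp s w - 2^-1 * \int[leb]_(t in `[-1, w]%classic) kern s t.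
Definition Jac s w : R :=
  s / hyp s w - 2^-1 * \int[leb]_(t in `[-1, w]%classic) dkern s t.

Lemma is_derive_kern s w : 3 / 2 < s -> -1 <= w ->
  is_derive s 1 (kern ^~ w) (dkern s w).
Proof.
move=> s1 w1; have h1 := hyp_ge1 s1 w1.
have d1 := is_derive_chiH s w; have d2 := is_derive_hyp_s s1 w1.
have h0 : hyp s w != 0 by rewrite gt_eqF; lra.
rewrite /kern /dkern; derive_eq.
by field.
Qed.

Lemma is_derive_slope s w : 3 / 2 < s -> -1 <= w ->
  is_derive s 1 (slope ^~ w) (dslope s w).
Proof.
move=> s1 w1; have h1 := hyp_ge1 s1 w1.
have d1 := is_derive_chiH s w; have d2 := is_derive_hyp_s s1 w1.
have h0 : hyp s w != 0 by rewrite gt_eqF; lra.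
rewrite /slope /dslope; derive_eq.
by field.
Qed.

Lemma continuous_hyp_w s w : 3 / 2 < s -> -1 <= w -> {for w, continuous (hyp s)}.
Proof. by move=> s1 w1; exact: is_derive_continuous (is_derive_hyp_w s1 w1). Qed.

Lemma continuous_hyp_s s w : 3 / 2 < s -> -1 <= w -> {for s, continuous (hyp ^~ w)}.
Proof. by move=> s1 w1; exact: is_derive_continuous (is_derive_hyp_s s1 w1). Qed.

Lemma hyp_neq0 s w : 3 / 2 < s -> -1 <= w -> hyp s w != 0.
Proof. by move=> s1 w1; rewrite gt_eqF // (lt_le_trans ltr01 (hyp_ge1 s1 w1)). Qed.

Lemma continuous_kern_w s w : 3 / 2 < s -> -1 <= w -> {for w, continuous (kern s)}.
Proof.
move=> s1 w1; apply: cvgM; first exact: continuous_chiH_w.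
by apply: cvgV; [exact: hyp_neq0|exact: continuous_hyp_w].
Qed.

Lemma continuous_slope_w s w : 3 / 2 < s -> -1 <= w -> {for w, continuous (slope s)}.
Proof.
move=> s1 w1; apply: cvgM.
  by apply: cvgB; [exact: cvg_cst|exact: continuous_chiH_w].
by apply: cvgV; [exact: hyp_neq0|exact: continuous_hyp_w].
Qed.

Lemma continuous_exp (T : topologicalType) (f : T -> R) n (x : T) :
  {for x, continuous f} -> {for x, continuous (fun y => f y ^+ n)}.
Proof.
move=> cf; exact: (@cvg_comp _ _ _ f (fun z => z ^+ n) _ _ _ cf (@exprn_continuous R n _)).
Qed.

Lemma continuous_dkern_w s w : 3 / 2 < s -> -1 <= w -> {for w, continuous (dkern s)}.
Proof.
move=> s1 w1; have c1 := @continuous_chiH_w s w; have c2 := @continuous_dchiH_w s w.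
have h0 := hyp_neq0 s1 w1; have c3 := continuous_hyp_w s1 w1.
apply: cvgB.
  apply: cvgN; apply: cvgM; last exact: cvgV.
  by apply: cvgM; [exact: cvg_cst|exact: c2].
apply: cvgM; last by apply: cvgV; [rewrite expf_neq0|exact: (@continuous_exp _ _ 3%N _ c3)].
by apply: cvgM; [exact: cvg_cst|exact: c1].
Qed.

Lemma continuous_dkern_s s w : 3 / 2 < s -> -1 <= w ->
  {for s, continuous (dkern ^~ w)}.
Proof.
move=> s1 w1; have c1 := is_derive_continuous (is_derive_chiH s w).
have c2 := @continuous_dchiH_s w s.
have h0 := hyp_neq0 s1 w1; have c3 := continuous_hyp_s s1 w1.
apply: cvgB.
  apply: cvgN; apply: cvgM; last exact: cvgV.
  by apply: cvgM; [exact: cvg_id|exact: c2].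
apply: cvgM; last by apply: cvgV; [rewrite expf_neq0|exact: (@continuous_exp _ _ 3%N _ c3)].
by apply: cvgM; [exact: cvg_id|exact: c1].
Qed.

Lemma continuous_dslope_w s w : 3 / 2 < s -> -1 <= w -> {for w, continuous (dslope s)}.
Proof.
move=> s1 w1; have c1 := @continuous_chiH_w s w; have c2 := @continuous_dchiH_w s w.
have h0 := hyp_neq0 s1 w1; have c3 := continuous_hyp_w s1 w1.
apply: cvgB.
  apply: cvgM; last exact: cvgV.
  by apply: cvgM; [exact: cvg_cst|exact: c2].
apply: cvgM; last by apply: cvgV; [rewrite expf_neq0|exact: (@continuous_exp _ _ 3%N _ c3)].
apply: cvgM; first exact: cvg_cst.
by apply: cvgB; [exact: cvg_cst|exact: c1].
Qed.

Lemma continuous_dslope_s s w : 3 / 2 < s -> -1 <= w ->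
  {for s, continuous (dslope ^~ w)}.
Proof.
move=> s1 w1; have c1 := is_derive_continuous (is_derive_chiH s w).
have c2 := @continuous_dchiH_s w s.
have h0 := hyp_neq0 s1 w1; have c3 := continuous_hyp_s s1 w1.
apply: cvgB.
  apply: cvgM; last exact: cvgV.
  by apply: cvgM; [exact: cvg_id|exact: c2].
apply: cvgM; last by apply: cvgV; [rewrite expf_neq0|exact: (@continuous_exp _ _ 3%N _ c3)].
apply: cvgM; first exact: cvg_id.
by apply: cvgB; [exact: cvg_cst|exact: c1].
Qed.

Lemma is_derive_Th_w s w : 3 / 2 < s -> -1 < w ->
  is_derive w 1 (Th s) (2^-1 * slope s w).
Proof.
move=> s1 w1; have d1 := is_derive_hyp_w s1 (ltW w1).
have d2 := is_derive_integral_left w1 (fun t => @continuous_kern_w s t s1).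
have h0 := hyp_neq0 s1 (ltW w1).
rewrite /Th /slope; derive_eq; rewrite /kern.
by field.
Qed.

(** The mixed derivative of [Th], equal to that obtained by differentiating [slope / 2] in [s]. On
    the leaves this reads d_a J = x^a d_s b, a compatibility that the pulled-back conservation law
    relies on. *)
Lemma is_derive_Jac_w s w : 3 / 2 < s -> -1 < w ->
  is_derive w 1 (Jac s) (2^-1 * dslope s w).
Proof.
move=> s1 w1; have d1 := is_derive_hyp_w s1 (ltW w1).
have d2 := is_derive_integral_left w1 (fun t => @continuous_dkern_w s t s1).
have h0 := hyp_neq0 s1 (ltW w1).
rewrite /Jac /dslope; derive_eq; rewrite /dkern.
by field.
Qed.

Lemma hypV_le1 s w : 3 / 2 < s -> -1 <= w -> 0 < (hyp s w)^-1 <= 1.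
Proof.
move=> s1 w1; have h1 := hyp_ge1 s1 w1.
have h0 := lt_le_trans ltr01 h1; by rewrite invr_gt0 h0 invf_le1.
Qed.

Lemma dchiH_ge0 s w : 0 <= dchiH s w. Proof. exact: cutoff_derive_ge0. Qed.

Lemma chiH_ge0_le1 s w : 0 <= chiH s w <= 1. Proof. exact: cutoff_ge0_le1 cchi _. Qed.

(** The sign makes J positive; the lower bound provides the domination for differentiating [Th]
    under the integral. *)
Lemma dkern_bound (M : R) s w : (forall y, dchi y <= M) -> 3 / 2 < s -> -1 <= w ->
  - (s * (M + 1)) <= dkern s w <= 0.
Proof.
move=> MP s1 w1; have /andP[h0 h1] := hypV_le1 s1 w1.
have d0 := dchiH_ge0 s w; have dM : dchiH s w <= M := MP _.
have /andP[c0 c1] := chiH_ge0_le1 s w.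
rewrite /dkern -exprVn; move: h0 h1 d0 dM c0 c1.
set h := (hyp s w)^-1; set d := dchiH s w; set c := chiH s w => h0 h1 d0 dM c0 c1.
have h3 : 0 <= h ^+ 3 <= 1 by rewrite exprn_ge0 ?exprn_ile1 // ltW.
have a1 : 0 <= d * h <= M by nra.
have a2 : 0 <= c * h ^+ 3 <= 1 by nra.
by rewrite -!mulrA; nra.
Qed.

Lemma dkern_bound_near (M : R) s x w : (forall y, dchi y <= M) -> 3 / 2 < s ->
  3 / 2 < x -> x < s + 1 -> -1 <= w -> `|dkern x w| <= (s + 1) * (M + 1).
Proof.
move=> MP s1 x1 xs w1; have M0 := le_trans (cutoff_derive_ge0 cchi 0) (MP 0).
by rewrite ler_norml; have := dkern_bound MP x1 w1; nra.
Qed.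

Lemma dslope_bound (M : R) s w : (forall y, dchi y <= M) -> 3 / 2 < s -> -1 <= w ->
  `|dslope s w| <= s * (M + 1).
Proof.
move=> MP s1 w1; have /andP[h0 h1] := hypV_le1 s1 w1.
have d0 := dchiH_ge0 s w; have dM : dchiH s w <= M := MP _.
have /andP[c0 c1] := chiH_ge0_le1 s w.
rewrite /dslope -exprVn; move: h0 h1 d0 dM c0 c1.
set h := (hyp s w)^-1; set d := dchiH s w; set c := chiH s w => h0 h1 d0 dM c0 c1.
have h3 : 0 <= h ^+ 3 <= 1 by rewrite exprn_ge0 ?exprn_ile1 // ltW.
have a1 : 0 <= d * h <= M by nra.
have a2 : 0 <= (1 - c) * h ^+ 3 <= 1 by nra.
by rewrite ler_norml -!mulrA; nra.
Qed.

Lemma integrable_segment (f : R -> R) (w : R) :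
  (forall t, -1 <= t -> {for t, continuous f}) ->
  leb.-integrable `[-1, w] (EFin \o f).
Proof.
move=> cf; apply: continuous_compact_integrable; first exact: segment_compact.
apply: continuous_in_subspaceT => t; rewrite inE /= in_itv /= => /andP[t1 _].
exact: cf.
Qed.

(** Differentiation under the integral sign, dominated by one constant for all parameters in ]3/2, s
    + 1[. *)
Lemma is_derive_Th_s s w : 3 / 2 < s -> -1 <= w ->
  is_derive s 1 (Th ^~ w) (Jac s w).
Proof.
move=> s1 w1; have d1 := is_derive_hyp_s s1 w1.
have [M M0 MP] := cutoff_derive_bounded cchi.
pose f (s t : R) := kern s t.
have E s' t : 3 / 2 < s' -> -1 <= t -> partial1of2 f s' t = dkern s' t.
  by move=> ? ?; rewrite partial1of2E; have [_ ->] := @is_derive_kern s' t ltac:(done) ltac:(done).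
have mI : measurable (`[-1, w]%classic : set (measurableTypeR R)) by exact: measurable_itv.
have Is : `]3 / 2, s + 1[%classic s by rewrite /= in_itv /= s1 ltrDl ltr01.
have int x : `]3 / 2, s + 1[%classic x -> leb.-integrable `[-1, w] (EFin \o f x).
  rewrite /= in_itv /= => /andP[x1 _].
  by apply: integrable_segment => t t1; exact: continuous_kern_w.
have df (x y : R) : `]3 / 2, s + 1[%classic x -> `[-1, w]%classic y ->
    derivable (f ^~ y) x 1.
  rewrite /= !in_itv /= => /andP[x1 _] /andP[y1 _].
  by have [] := is_derive_kern x1 y1.
have G0 (y : R) : 0 <= (s + 1) * (M + 1) by nra.
have intG : leb.-integrable `[-1, w] (EFin \o (fun=> (s + 1) * (M + 1))).
  by apply: integrable_segment => t _; exact: cvg_cst.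
have Gub (x y : R) : `]3 / 2, s + 1[%classic x -> `[-1, w]%classic y ->
    `|partial1of2 f x y| <= (s + 1) * (M + 1).
  rewrite /= !in_itv /= => /andP[x1 x2] /andP[y1 _].
  by rewrite E //; exact: dkern_bound_near.
have d2 : is_derive s 1 (fun s => \int[leb]_(t in `[-1, w]%classic) kern s t)
    (\int[leb]_(t in `[-1, w]%classic) dkern s t).
  apply: DeriveDef.
    exact: (derivable_under_integral mI Is int df G0 intG Gub).
  rewrite -derive1E (differentiation_under_integral mI Is int df G0 intG Gub).
  apply: eq_Rintegral => t; rewrite inE /= in_itv /= => /andP[t1 _].
  exact: E.
rewrite /Th /Jac; derive_eq.
by ring.
Qed.

Lemma continuous_Jac_s s w : 3 / 2 < s -> -1 <= w ->
  {for s, continuous (Jac ^~ w)}.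
Proof.
move=> s1 w1; have c1 := continuous_hyp_s s1 w1.
have [M M0 MP] := cutoff_derive_bounded cchi.
have mI : measurable (`[-1, w]%classic : set (measurableTypeR R)) by exact: measurable_itv.
have Is : s \in `]3 / 2, s + 1[%classic by rewrite inE /= in_itv /= s1 ltrDl ltr01.
apply: cvgB.
  by apply: cvgM; [exact: cvg_id|apply: cvgV => //; exact: hyp_neq0].
apply: cvgM; first exact: cvg_cst.
apply: (continuity_under_integral mI (u := 3 / 2) (v := s + 1)
  (g := fun=> (s + 1) * (M + 1)) _ _ _ _ Is).
- move=> x; rewrite /= in_itv /= => /andP[x1 _].
  by apply: integrable_segment => t t1; exact: continuous_dkern_w.
- apply: aeW => y; rewrite /= in_itv /= => /andP[y1 _] x.
  rewrite inE /= in_itv /= => /andP[x1 _].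
  exact: continuous_dkern_s.
- by apply: integrable_segment => t _; exact: cvg_cst.
- move=> x; rewrite /= in_itv /= => /andP[x1 x2]; apply: aeW => y.
  rewrite /= in_itv /= => /andP[y1 _].
  exact: dkern_bound_near.
Qed.

(** As [dkern] is nonpositive, the integral only adds to the positive term s / hyp. Consequently
    [Th] increases with [s], which is what keeps the intermediate leaves inside the slab. *)
Lemma Jac_gt0 s w : 3 / 2 < s -> -1 <= w -> 0 < Jac s w.
Proof.
move=> s1 w1; have [M M0 MP] := cutoff_derive_bounded cchi.
have /andP[h0 h1] := hypV_le1 s1 w1.
have a : 0 < s / hyp s w by rewrite mulr_gt0 //; lra.
have I0 : 0 <= \int[leb]_(t in `[-1, w]%classic) (- dkern s t).
  apply: Rintegral_ge0 => t /=; rewrite in_itv /= => /andP[t1 _].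
  by have := dkern_bound MP s1 t1; lra.
have E : \int[leb]_(t in `[-1, w]%classic) (- dkern s t) =
    - \int[leb]_(t in `[-1, w]%classic) dkern s t.
  rewrite -[RHS]mulN1r -RintegralZl //.
    by apply: eq_Rintegral => t _; rewrite mulN1r.
  by apply: integrable_segment => t t1; exact: continuous_dkern_w.
rewrite E oppr_ge0 in I0.
by rewrite /Jac (lt_le_trans a) // lerDl oppr_ge0 pmulr_rle0.
Qed.

Lemma kern_ge0_le1 s w : 3 / 2 < s -> -1 <= w -> 0 <= kern s w <= 1.
Proof.
move=> s1 w1; have /andP[h0 h1] := hypV_le1 s1 w1.
have /andP[c0 c1] := chiH_ge0_le1 s w; rewrite /kern.
by rewrite mulr_ge0 ?mulr_ile1 // ltW.
Qed.

Lemma slope_ge0_le1 s w : 3 / 2 < s -> -1 <= w -> 0 <= slope s w <= 1.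
Proof.
move=> s1 w1; have /andP[h0 h1] := hypV_le1 s1 w1.
have /andP[c0 c1] := chiH_ge0_le1 s w; rewrite /slope.
by rewrite mulr_ge0 ?mulr_ile1 ?subr_ge0 ?gerBl // ltW.
Qed.

Lemma norm_integral_segment (f : R -> R) (w D : R) : -1 <= w ->
  (forall t, -1 <= t -> {for t, continuous f}) ->
  (forall t, -1 <= t -> `|f t| <= D) ->
  `|\int[leb]_(t in `[-1, w]%classic) f t| <= D * (w + 1).
Proof.
move=> w1 cf fD.
have mI : measurable (`[-1, w]%classic : set (measurableTypeR R)) by exact: measurable_itv.
have i := integrable_segment w cf.
apply: le_trans (le_normr_Rintegral mI i) _.
have -> : D * (w + 1) = \int[leb]_(t in `[-1, w]%classic) D.
  rewrite Rintegral_cst //= lebesgue_measure_itv /= lte_fin.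
  case: ltP => [_|wle]; first by rewrite /= opprK.
  have -> : w = -1 by apply/eqP; rewrite eq_le wle w1.
  by rewrite addNr.
apply: le_Rintegral => //.
- exact: integrable_norm.
- by apply: integrable_segment => t _; exact: cvg_cst.
- by move=> t /=; rewrite in_itv /= => /andP[t1 _]; exact: fD.
Qed.

Lemma hyp_le s w : 3 / 2 < s -> -1 <= w -> hyp s w <= s + w + 1.
Proof.
move=> s1 w1; have h1 := hyp_ge1 s1 w1; have h2 := sqr_hyp s1 w1; nra.
Qed.

(** Deliberately crude: T grows at most linearly in r, but a bound linear in w = r^2 is enough
    against the decay of u. *)
Lemma Th_bound s w : 3 / 2 < s -> 0 <= w -> `|Th s w| <= s + 2 * (w + 1).
Proof.
move=> s1 w0; have w1 : -1 <= w by rewrite (le_trans _ w0) // oppr_le0.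
have h0 : 0 <= hyp s w by exact: sqrtr_ge0.
have h1 := hyp_le s1 w1.
have k : `|\int[leb]_(t in `[-1, w]%classic) kern s t| <= 1 * (w + 1).
  apply: norm_integral_segment => // t t1; first exact: continuous_kern_w.
  by have /andP[k0 k1] := kern_ge0_le1 s1 t1; rewrite ger0_norm.
rewrite /Th (le_trans (ler_normB _ _)) // normrM (ger0_norm h0) gtr0_norm //.
by move: k; set I := `|_| => k; lra.
Qed.

Lemma Jac_bound (M : R) s w : (forall y, dchi y <= M) -> 3 / 2 < s -> 0 <= w ->
  `|Jac s w| <= s * (M + 2) * (w + 1).
Proof.
move=> MP s1 w0; have w1 : -1 <= w by rewrite (le_trans _ w0) // oppr_le0.
have M0 := le_trans (cutoff_derive_ge0 cchi 0) (MP 0).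
have /andP[h0 h1] := hypV_le1 s1 w1.
have k : `|\int[leb]_(t in `[-1, w]%classic) dkern s t| <= s * (M + 1) * (w + 1).
  apply: norm_integral_segment => // t t1; first exact: continuous_dkern_w.
  have /andP[k0 k1] := dkern_bound MP s1 t1.
  by rewrite ler0_norm // lerNl.
have s0 : 0 < s by lra.
rewrite /Jac (le_trans (ler_normB _ _)) // normrM (ger0_norm (ltW s0)).
rewrite (ger0_norm (ltW h0)) normrM gtr0_norm //.
move: k; set I := `|_|; set h := (hyp s w)^-1 in h0 h1 *; move=> k.
have -> : s * (M + 2) * (w + 1) = s * (M + 1) * (w + 1) + s * w + s by ring.
have a1 : s * h <= s by nra.
have a2 : 0 <= s * (M + 1) * (w + 1).
  by rewrite !mulr_ge0 ?addr_ge0 // ltW.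
have a3 : 0 <= s * w by rewrite mulr_ge0 // ltW.
by lra.
Qed.

Lemma Th0 s : 3 / 2 < s -> Th s 0 = s.
Proof.
move=> s1; rewrite /Th /hyp addr0 sqrtr_sqr ger0_norm; last by lra.
have -> : \int[leb]_(t in `[-1, 0]%classic) kern s t = 0.
  transitivity (\int[leb]_(t in `[-1, 0]%classic) (0 : R)); last first.
    by rewrite Rintegral_cst ?mul0r.
  apply: eq_Rintegral => t; rewrite inE /= in_itv /= => /andP[_ t0].
  (* For t <= 0 the root is 0, so the cutoff is evaluated at the negative number - rhoH s. *)
  rewrite /kern /chiH (ler0_sqrtr t0) sub0r.
  case: cchi => _ _ -> //; first by rewrite mul0r.
  by rewrite /rhoH; nra.
by rewrite mulr0 subr0.
Qed.

Lemma xi_slope s r : 0 <= r ->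
  xi chi s r / Num.sqrt (s ^+ 2 + r ^+ 2) = slope s (r ^+ 2).
Proof. by move=> r0; rewrite /xi /slope /chiH /hyp sqrtr_sqr ger0_norm. Qed.

Lemma Th_le s s' w : 3 / 2 < s -> s <= s' -> -1 <= w -> Th s w <= Th s' w.
Proof.
move=> s1 ss w1.
have D (x : R) : x \in `]s, s'[ -> is_derive x 1 (Th ^~ w) (Jac x w).
  rewrite in_itv /= => /andP[sx _]; apply: is_derive_Th_s => //; lra.
have C : {within `[s, s'], continuous (Th ^~ w)}.
  apply: derivable_within_continuous => x; rewrite in_itv /= => /andP[sx _].
  by have [] := @is_derive_Th_s x w ltac:(lra) w1.
have [c + E] := MVT_segment ss D C.
rewrite in_itv /= => /andP[sc _].
have j : 0 < Jac c w by apply: Jac_gt0 => //; lra.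
by rewrite -subr_ge0 E; apply: mulr_ge0; [exact: ltW|rewrite subr_ge0].
Qed.

(** * Identification of [T] and of its derivative in [s] with the explicit formulas *)

Section time_function_formula.
Variable T : R -> R -> R.
Hypothesis Ttime : time_function chi T.

(** Uniqueness for the equation defining [T]: the difference has zero derivative on ]0, r[, is
    continuous up to 0 and vanishes there. Regularity of [T] in [s] is thereby inherited from
    [Th]. *)
Lemma time_functionE s r : 2 <= s -> 0 <= r -> T s r = Th s (r ^+ 2).
Proof.
move=> s2 r0; have s1 : 3 / 2 < s by lra.
have [T0 Tc Td] := Ttime s2.
have dTh (x : R) : is_derive x 1 (fun x => Th s (x ^+ 2)) (x * slope s (x ^+ 2)).
  have x2 : -1 < x ^+ 2 by rewrite (lt_le_trans _ (sqr_ge0 x)) // oppr_lt0.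
  have d1 : is_derive x 1 (fun x : R => x ^+ 2) (2 * x).
    by derive_eq; rewrite /=; ring.
  have H := @is_derive1_comp R (Th s) (fun x => x ^+ 2) x _ _ (is_derive_Th_w s1 x2) d1.
  by notypeclasses refine (derive_ext H _); field.
pose D x := T s x - Th s (x ^+ 2).
have dD (x : R) : x \in `]0, r[ -> is_derive x 1 D 0.
  rewrite in_itv /= => /andP[x0 _].
  have d1 := Td x x0; have d2 := dTh x.
  rewrite /D; derive_eq.
  by rewrite -xi_slope ?ltW // ; ring.
have cD : {within `[0, r], continuous D}.
  have c1 : {within `[0, r], continuous (T s)}.
    by apply: continuous_subspaceW Tc; apply: subset_itvl.
  have c2 : {within `[0, r], continuous (fun x => Th s (x ^+ 2))}.
    by apply: continuous_subspaceT => x; exact: is_derive_continuous (dTh x).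
  by move=> x; exact: (cvgB (c1 x) (c2 x)).
have [c _] := MVT_segment r0 dD cD.
rewrite /D mul0r T0 expr0n /= Th0 // subrr subr0.
by move/eqP; rewrite subr_eq0 => /eqP.
Qed.

(** The inequality is strict because a derivative at [s] needs the formula for [T] on both sides of
    [s]. *)
Lemma jacE s r : 2 < s -> 0 <= r -> jac T s r = Jac s (r ^+ 2).
Proof.
move=> s2 r0; rewrite /jac derive1E.
have r2 : -1 <= r ^+ 2 by rewrite (le_trans _ (sqr_ge0 r)) // oppr_le0.
have [_ <-] := @is_derive_Th_s s (r ^+ 2) ltac:(lra) r2.
apply: near_eq_derive => //; near=> z.
apply: time_functionE => //; apply: ltW; near: z; exact: lt_nbhsr.
Unshelve. all: by end_near. Qed.

End time_function_formula.

End foliation_time.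

(** * Decay and differentiation along the slices *)

Section tame.
Variable R : realType.
Variables s0 s1 : R.
Implicit Types (f g : R -> R * R -> R) (x : R * R) (k l : int).

Lemma japanese_ge1 x : 1 <= japanese x.
Proof.
by rewrite -[leLHS]sqrtr1 ler_sqrt ?lerDl ?sqr_ge0 // addr_ge0 // sqr_ge0.
Qed.

Lemma japanese_gt0 x : 0 < japanese x.
Proof. exact: lt_le_trans ltr01 (japanese_ge1 x). Qed.

Lemma radius_ge0 x : 0 <= radius x. Proof. exact: sqrtr_ge0. Qed.

Lemma sqr_radius x : radius x ^+ 2 = x.1 ^+ 2 + x.2 ^+ 2.
Proof. by rewrite sqr_sqrtr // addr_ge0 // sqr_ge0. Qed.

Lemma sqr_japanese x : japanese x ^+ 2 = 1 + x.1 ^+ 2 + x.2 ^+ 2.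
Proof. by rewrite sqr_sqrtr ?sqr_radius ?addrA // !addr_ge0 // sqr_ge0. Qed.

(* Separate continuity in [s] and in [x] suffices: the integrals are over [x]
   at fixed [s], and only their dependence on [s] is studied. *)
Definition tame k f : Prop :=
  [/\ exists C : R, forall s x, s0 <= s <= s1 -> `|f s x| <= C * japanese x ^ k,
      forall s, s0 <= s <= s1 -> continuous (f s) &
      forall s x, s0 <= s <= s1 -> {for s, continuous (f ^~ x)}].

Lemma tame_bound_ge0 k f (C : R) :
  (forall s x, s0 <= s <= s1 -> `|f s x| <= C * japanese x ^ k) ->
  s0 <= s1 -> 0 <= C.
Proof.
move=> fC s01; have := fC s0 (0, 0) ltac:(by rewrite lexx).
by move/(le_trans (normr_ge0 _)); rewrite pmulr_lge0 // exprz_gt0 // japanese_gt0.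
Qed.

Hypothesis s01 : s0 <= s1.

Lemma tameW k l f : (k <= l)%R -> tame k f -> tame l f.
Proof.
move=> kl [[C fC] c1 c2]; split => //; exists C => s x sI.
rewrite (le_trans (fC s x sI)) // ler_wpM2l //; first exact: tame_bound_ge0 fC s01.
by apply: ler_weXz2l => //; exact: japanese_ge1.
Qed.

Lemma tameD k l f g : tame k f -> tame l g ->
  tame (Num.max k l) (fun s x => f s x + g s x).
Proof.
move=> tf tg.
have kM : k <= Num.max k l by rewrite le_max lexx.
have lM : l <= Num.max k l by rewrite le_max lexx orbT.
have [[C fC] cf1 cf2] := tameW kM tf; have [[D gD] cg1 cg2] := tameW lM tg.
split=> [|s sI x|s x sI].
- exists (C + D) => s x sI; rewrite (le_trans (ler_normD _ _)) // mulrDl.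
  exact: lerD (fC s x sI) (gD s x sI).
- by apply: cvgD; [exact: cf1|exact: cg1].
- by apply: cvgD; [exact: cf2|exact: cg2].
Qed.

Lemma tameN k f : tame k f -> tame k (fun s x => - f s x).
Proof.
move=> [[C fC] cf1 cf2]; split=> [|s sI x|s x sI].
- by exists C => s x sI; rewrite normrN; exact: fC.
- by apply: cvgN; exact: cf1.
- by apply: cvgN; exact: cf2.
Qed.

Lemma tameM k l f g : tame k f -> tame l g ->
  tame (k + l) (fun s x => f s x * g s x).
Proof.
move=> [[C fC] cf1 cf2] [[D gD] cg1 cg2]; split=> [|s sI x|s x sI].
- exists (C * D) => s x sI; rewrite normrM expfzDr ?gt_eqF ?japanese_gt0 //.
  by rewrite mulrACA ler_pM // ?fC ?gD.
- by apply: cvgM; [exact: cf1|exact: cg1].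
- by apply: cvgM; [exact: cf2|exact: cg2].
Qed.

Lemma tame_cst (c : R) : tame 0 (fun _ _ => c).
Proof.
split=> [|s sI x|s x sI]; [|exact: cvg_cst|exact: cvg_cst].
by exists `|c| => s x sI; rewrite expr0z mulr1.
Qed.

Lemma tameX2 k f : tame k f -> tame (k + k) (fun s x => f s x ^+ 2).
Proof. by move=> tf; under eq_fun do under eq_fun do rewrite expr2; exact: tameM. Qed.

Lemma tame_x1 : tame 1 (fun _ x => x.1).
Proof.
split=> [|s sI x|s x sI]; [|exact: cvg_fst|exact: cvg_cst].
exists 1 => s x sI; rewrite mul1r expr1z -sqrtr_sqr ler_sqrt ?addr_ge0 ?sqr_ge0 //.
by rewrite sqr_radius; have := sqr_ge0 x.2; lra.
Qed.

Lemma tame_x2 : tame 1 (fun _ x => x.2).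
Proof.
split=> [|s sI x|s x sI]; [|exact: cvg_snd|exact: cvg_cst].
exists 1 => s x sI; rewrite mul1r expr1z -sqrtr_sqr ler_sqrt ?addr_ge0 ?sqr_ge0 //.
by rewrite sqr_radius; have := sqr_ge0 x.1; lra.
Qed.

(** The exponent -4 comes from (1 + x1^2) (1 + x2^2) <= (1 + x1^2 + x2^2)^2 = <x>^4. *)
Lemma tame_weight f : tame (-4) f ->
  exists C : R, forall s x, s0 <= s <= s1 -> `|f s x| <= C * weight x.
Proof.
move=> [[C fC] _ _]; exists C => s x sI; rewrite (le_trans (fC s x sI)) //.
rewrite ler_wpM2l ?(tame_bound_ge0 fC) // /weight -invfM lef_pV2 //.
- have -> : japanese x ^+ 4 = (japanese x ^+ 2) ^+ 2 by rewrite -exprM.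
  rewrite sqr_japanese /oneDsqr; have := sqr_ge0 x.1; have := sqr_ge0 x.2.
  by nra.
- by rewrite posrE exprn_gt0 // japanese_gt0.
- by rewrite posrE mulr_gt0 // oneDsqr_pos.
Qed.

End tame.

(** * Geometry of the leaves and restriction of fields to them *)

Section slice_fields.
Variables (R : realType) (chi : R -> R).
Hypothesis cchi : cutoff chi.
Variables s0 s1 : R.
Hypothesis s0_ge2 : 2 <= s0.
Hypothesis s01 : s0 <= s1.
Implicit Types (s : R) (x : R * R).
Local Notation tame := (tame s0 s1).

(** The data of F_s over the plane: the leaf is t = [tF], with gradient x^a [bF], where b = xi /
    (s^2 + r^2)^(1/2); [jF] is J and [dbF] is d_s b. They are built from [Th] rather than [T] in
    order to be differentiable at s = 2. *)
Definition sqn x : R := x.1 ^+ 2 + x.2 ^+ 2.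
Definition tF s x : R := Th chi s (sqn x).
Definition bF s x : R := slope chi s (sqn x).
Definition jF s x : R := Jac chi s (sqn x).
Definition dbF s x : R := dslope chi s (sqn x).
Definition sl s x : spacetime R := (tF s x, x).

Lemma sqn_ge0 x : 0 <= sqn x. Proof. by rewrite addr_ge0 // sqr_ge0. Qed.

Lemma sqn_gtN1 x : -1 < sqn x.
Proof. by rewrite (lt_le_trans _ (sqn_ge0 x)) // oppr_lt0. Qed.

Lemma sqn_geN1 x : -1 <= sqn x. Proof. exact/ltW/sqn_gtN1. Qed.

Lemma continuous_sqn : continuous sqn.
Proof.
move=> x; apply: cvgD; apply: continuous_exp; [exact: cvg_fst|exact: cvg_snd].
Qed.

Lemma sI_gt s : s0 <= s <= s1 -> 3 / 2 < s. Proof. by move=> /andP[+ _]; have := s0_ge2; lra. Qed.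

Lemma sqr_japanese_sqn x : japanese x ^ 2 = sqn x + 1.
Proof. by rewrite -exprnP sqr_japanese /sqn; ring. Qed.

(** Degree [k] in [w] becomes order 2k, because w + 1 = <x>^2. *)
Lemma tame_sqn_section (h : R -> R -> R) (C : R) (k : nat) :
  (forall s w, s0 <= s <= s1 -> 0 <= w -> `|h s w| <= C * (w + 1) ^+ k) ->
  (forall s w, s0 <= s <= s1 -> -1 < w -> {for w, continuous (h s)}) ->
  (forall s w, s0 <= s <= s1 -> -1 < w -> {for s, continuous (h ^~ w)}) ->
  tame (2 * k%:Z) (fun s x => h s (sqn x)).
Proof.
move=> hC c1 c2; split=> [|s sI x|s x sI].
- exists C => s x sI; rewrite -exprz_exp sqr_japanese_sqn -exprnP.
  by apply: hC => //; exact: sqn_ge0.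
- exact: (@cvg_comp _ _ _ sqn (h s) _ _ _ (@continuous_sqn x) (c1 _ _ sI (sqn_gtN1 x))).
- by apply: c2 => //; exact: sqn_gtN1.
Qed.

Lemma tame_t : tame 2 tF.
Proof.
apply: (@tame_sqn_section (Th chi) (s1 + 2) 1) => s w sI w0.
- have s3 := sI_gt sI; have /andP[_ ss1] := sI.
  by rewrite (le_trans (Th_bound cchi s3 w0)) // expr1; nra.
- exact: is_derive_continuous (is_derive_Th_w cchi (sI_gt sI) w0).
- exact: is_derive_continuous (is_derive_Th_s cchi (sI_gt sI) (ltW w0)).
Qed.

Lemma tame_b : tame 0 bF.
Proof.
apply: (@tame_sqn_section (slope chi) 1 0) => s w sI w0.
- have w1 : -1 <= w by rewrite (le_trans _ w0) // oppr_le0.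
  have /andP[h0 h1] := slope_ge0_le1 cchi (sI_gt sI) w1.
  by rewrite expr0 mulr1 ger0_norm.
- exact: (continuous_slope_w cchi (sI_gt sI) (ltW w0)).
- exact: is_derive_continuous (is_derive_slope cchi (sI_gt sI) (ltW w0)).
Qed.

Lemma tame_j : tame 2 jF.
Proof.
have [M M0 MP] := cutoff_derive_bounded cchi.
apply: (@tame_sqn_section (Jac chi) (s1 * (M + 2)) 1) => s w sI w0.
- have s3 := sI_gt sI; have /andP[_ ss1] := sI.
  rewrite (le_trans (Jac_bound cchi MP s3 w0)) // expr1.
  by apply: ler_wpM2r; [lra|apply: ler_wpM2r; lra].
- exact: is_derive_continuous (is_derive_Jac_w cchi (sI_gt sI) w0).
- exact: (continuous_Jac_s cchi (sI_gt sI) (ltW w0)).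
Qed.

Lemma tame_db : tame 0 dbF.
Proof.
have [M M0 MP] := cutoff_derive_bounded cchi.
apply: (@tame_sqn_section (dslope chi) (s1 * (M + 1)) 0) => s w sI w0.
- have w1 : -1 <= w by rewrite (le_trans _ w0) // oppr_le0.
  have /andP[_ ss1] := sI.
  rewrite expr0 mulr1 (le_trans (dslope_bound cchi MP (sI_gt sI) w1)) //.
  by apply: ler_wpM2r; lra.
- exact: (continuous_dslope_w cchi (sI_gt sI) (ltW w0)).
- exact: (continuous_dslope_s cchi (sI_gt sI) (ltW w0)).
Qed.

(** The left side is the value of zeta^2 on the hyperboloid, xi = 1, which is the smallest possible
    since 0 <= xi <= 1. Hence 1 / zeta^2 <= 1 + r^2 / s^2, of order 2. *)
Lemma bF_hyp s x : s0 <= s <= s1 -> s ^+ 2 / (s ^+ 2 + sqn x) <= 1 - bF s x ^+ 2 * sqn x.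
Proof.
move=> sI; have s3 := sI_gt sI; have w0 := sqn_ge0 x.
have /andP[c0 c1] := chiH_ge0_le1 cchi s (sqn x).
have hw := sqr_hyp s3 (sqn_geN1 x).
have p : 0 < s ^+ 2 + sqn x by nra.
rewrite /bF /slope expr_div_n hw.
have -> : 1 - (1 - chiH chi s (sqn x)) ^+ 2 / (s ^+ 2 + sqn x) * sqn x =
  (s ^+ 2 + (1 - (1 - chiH chi s (sqn x)) ^+ 2) * sqn x) / (s ^+ 2 + sqn x).
  by field; rewrite gt_eqF.
rewrite ler_pM2r ?invr_gt0 // lerDl mulr_ge0 //.
by move: c0 c1; set c := chiH _ _ _ => *; nra.
Qed.

Lemma zeta2_gt0 s x : s0 <= s <= s1 -> 0 < 1 - bF s x ^+ 2 * sqn x.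
Proof.
move=> sI; apply: lt_le_trans (bF_hyp x sI).
have s3 := sI_gt sI; have w0 := sqn_ge0 x.
by rewrite divr_gt0 //; nra.
Qed.

Lemma tame_inv_zeta2 : tame 2 (fun s x => (1 - bF s x ^+ 2 * sqn x)^-1).
Proof.
have [_ cb1 cb2] := tame_b.
split=> [|s sI x|s x sI].
- exists 1 => s x sI; rewrite mul1r sqr_japanese_sqn.
  have s3 := sI_gt sI; have w0 := sqn_ge0 x; have z0 := zeta2_gt0 x sI.
  rewrite ger0_norm; last by rewrite invr_ge0 ltW.
  apply: (@le_trans _ _ (s ^+ 2 / (s ^+ 2 + sqn x))^-1).
    by rewrite lef_pV2 ?bF_hyp // posrE divr_gt0 //; nra.
  have s2 : 1 <= s ^+ 2 by nra.
  rewrite invf_div ler_pdivrMr ?(lt_le_trans ltr01) // mulrDl mul1r.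
  by rewrite [leRHS]addrC lerD2l ler_peMr.
- apply: cvgV; first by rewrite gt_eqF // zeta2_gt0.
  apply: cvgB; first exact: cvg_cst.
  by apply: cvgM; [apply: continuous_exp; exact: cb1|exact: continuous_sqn].
- apply: cvgV; first by rewrite gt_eqF // zeta2_gt0.
  apply: cvgB; first exact: cvg_cst.
  by apply: cvgM; [exact: (@continuous_exp _ _ _ 2%N _ (cb2 s x sI))|exact: cvg_cst].
Qed.

Local Opaque Th Jac slope dslope.

Section field.
Variable U : set (spacetime R).
Hypothesis oU : open U.
Hypothesis slU : forall s x, s0 <= s <= s1 -> U (sl s x).

Lemma continuous_sl_x s : s0 <= s <= s1 -> continuous (sl s).
Proof.
move=> sI x; have [_ c1 _] := tame_t.
apply: (@cvg_pair _ _ _ _ (nbhs (tF s x)) (nbhs x)); first exact: c1.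
exact: cvg_id.
Qed.

Lemma continuous_sl_s s x : s0 <= s <= s1 -> {for s, continuous (sl ^~ x)}.
Proof.
move=> sI; have [_ _ c2] := tame_t.
apply: (@cvg_pair _ _ _ _ (nbhs (tF s x)) (nbhs x)); first exact: c2.
exact: cvg_cst.
Qed.

Lemma tame_field (f : spacetime R -> R) (m : nat) (C : R) :
  {in U, continuous f} ->
  (forall s x, s0 <= s <= s1 -> `|f (sl s x)| <= C * japanese x ^- m) ->
  tame (- m%:Z) (fun s x => f (sl s x)).
Proof.
move=> cf fC; split=> [|s sI x|s x sI].
- exists C => s x sI; rewrite -exprnN; exact: fC.
- apply: (cvg_comp _ _ (@continuous_sl_x s sI x)); apply: cf; rewrite inE; exact: slU.
- apply: (cvg_comp _ _ (@continuous_sl_s s x sI)); apply: cf; rewrite inE; exact: slU.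
Qed.

Lemma is_derive_tF_s s x : s0 <= s <= s1 -> is_derive s 1 (tF ^~ x) (jF s x).
Proof. by move=> sI; exact: (is_derive_Th_s cchi (sI_gt sI) (sqn_geN1 x)). Qed.

Lemma is_derive_bF_s s x : s0 <= s <= s1 -> is_derive s 1 (bF ^~ x) (dbF s x).
Proof. by move=> sI; exact: (is_derive_slope cchi (sI_gt sI) (sqn_geN1 x)). Qed.

(** From d(r^2) = 2 x dx no quotient x / r ever arises, so the origin is not exceptional; the 2
    cancels the factor 1/2 in the derivatives of [Th] and [Jac]. *)
Lemma is_derive_sqn_section (h : R -> R) (d : R) (x : R * R) :
  is_derive (sqn x) 1 h (2^-1 * d) ->
  is_derive x.1 1 (fun y => h (sqn (y, x.2))) (x.1 * d) /\
  is_derive x.2 1 (fun y => h (sqn (x.1, y))) (x.2 * d).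
Proof.
case: x => a b /= dh.
have d1 : is_derive a 1 (fun y => sqn (y, b)) (2 * a).
  by rewrite /sqn /=; derive_eq; rewrite /=; ring.
have d2 : is_derive b 1 (fun y => sqn (a, y)) (2 * b).
  by rewrite /sqn /=; derive_eq; rewrite /=; ring.
have H1 := @is_derive1_comp R h (fun y => sqn (y, b)) a _ _ dh d1.
have H2 := @is_derive1_comp R h (fun y => sqn (a, y)) b _ _ dh d2.
by split; [notypeclasses refine (derive_ext H1 _)|notypeclasses refine (derive_ext H2 _)]; field.
Qed.

Lemma is_derive_tF_x s x : s0 <= s <= s1 ->
  is_derive x.1 1 (fun y => tF s (y, x.2)) (x.1 * bF s x) /\
  is_derive x.2 1 (fun y => tF s (x.1, y)) (x.2 * bF s x).
Proof.
by move=> sI; apply: is_derive_sqn_section; exact: (is_derive_Th_w cchi (sI_gt sI) (sqn_gtN1 x)).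
Qed.

Lemma is_derive_jF_x s x : s0 <= s <= s1 ->
  is_derive x.1 1 (fun y => jF s (y, x.2)) (x.1 * dbF s x) /\
  is_derive x.2 1 (fun y => jF s (x.1, y)) (x.2 * dbF s x).
Proof.
by move=> sI; apply: is_derive_sqn_section; exact: (is_derive_Jac_w cchi (sI_gt sI) (sqn_gtN1 x)).
Qed.

Let chain_s (p q r d : R) : p * d + q * 0 + r * 0 = p * d.
Proof. by rewrite !mulr0 !addr0. Qed.
Let chain_x1 (p q r d : R) : p * d + q * 1 + r * 0 = p * d + q.
Proof. by rewrite mulr0 mulr1 addr0. Qed.
Let chain_x2 (p q r d : R) : p * d + q * 0 + r * 1 = p * d + r.
Proof. by rewrite mulr0 mulr1 addr0. Qed.

Section derivatives.
Variable f : spacetime R -> R.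
Hypothesis df : forall i p, U p -> derivable f p (@dir R i).
Hypothesis cdf : forall i, {in U, continuous (partial i f)}.

Lemma is_derive_field_s s x : s0 <= s <= s1 ->
  is_derive s 1 (fun s => f (sl s x)) (partial 0 f (sl s x) * jF s x).
Proof.
move=> sI; case: x => a b.
have d0 := is_derive_tF_s (a, b) sI.
have H := @is_derive_curve _ f U (fun s => tF s (a, b)) (fun=> a) (fun=> b) s
  _ _ _ oU (slU _ sI) df cdf d0 (derive_cst_fun a s) (derive_cst_fun b s).
exact: (derive_ext H (chain_s _ _ _ _)).
Qed.

Lemma is_derive_field_x s x : s0 <= s <= s1 ->
  is_derive x.1 1 (fun y => f (sl s (y, x.2)))
    (partial 0 f (sl s x) * (x.1 * bF s x) + partial 1 f (sl s x)) /\
  is_derive x.2 1 (fun y => f (sl s (x.1, y)))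
    (partial 0 f (sl s x) * (x.2 * bF s x) + partial 2%:R f (sl s x)).
Proof.
move=> sI; have [d1 d2] := is_derive_tF_x x sI.
case: x d1 d2 => a b /= d1 d2.
have H1 := @is_derive_curve _ f U (fun y => tF s (y, b)) id (fun=> b) a
  _ _ _ oU (slU _ sI) df cdf d1 (derive_id_fun a) (derive_cst_fun b a).
have H2 := @is_derive_curve _ f U (fun y => tF s (a, y)) (fun=> a) id b
  _ _ _ oU (slU _ sI) df cdf d2 (derive_cst_fun a b) (derive_id_fun b).
split; first exact: (derive_ext H1 (chain_x1 _ _ _ _)).
exact: (derive_ext H2 (chain_x2 _ _ _ _)).
Qed.

End derivatives.
End field.
End slice_fields.

(** * The conformal multiplier identity *)

Section conformal_identity.
Variable R : realType.
Implicit Types t b v a c d j db : R.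

(** The arguments v, a, c, d stand for u, u_t, u_1, u_2. The summand t u compensates the multiple of
    t (u_t^2 - |grad u|^2) that the conformal vector field alone leaves outside the divergence. *)
Definition multiplier t (x1 x2 : R) v a c d : R :=
  (t ^+ 2 + (x1 ^+ 2 + x2 ^+ 2)) * a + 2 * t * (x1 * c + x2 * d) + t * v.

(** The component V_1 of the current; V_2 results from exchanging x1 with x2 and c with d. *)
Definition flux t (x1 x2 : R) v a c d : R :=
  - (multiplier t x1 x2 v a c d * c)
  + t * x1 * (c ^+ 2 + d ^+ 2 - a ^+ 2).

(** The flux of the current through F_s: its time component minus b x^a V_a. The term - u^2 / 2
    turns the product u u_t, left over by the summand t u of the multiplier, into a divergence. *)
Definition density t b (x1 x2 : R) v a c d : R :=
  2^-1 * (t ^+ 2 + (x1 ^+ 2 + x2 ^+ 2) + 2 * b * t * (x1 ^+ 2 + x2 ^+ 2)) * a ^+ 2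
  + 2^-1 * (t ^+ 2 + (x1 ^+ 2 + x2 ^+ 2) - 2 * b * t * (x1 ^+ 2 + x2 ^+ 2))
    * (c ^+ 2 + d ^+ 2)
  + ((2 * t * x1 + b * (t ^+ 2 + (x1 ^+ 2 + x2 ^+ 2)) * x1) * a * c
     + (2 * t * x2 + b * (t ^+ 2 + (x1 ^+ 2 + x2 ^+ 2)) * x2) * a * d)
  + 2 * t * b * (x1 * c + x2 * d) ^+ 2
  + t * v * (a + b * (x1 * c + x2 * d))
  - 2^-1 * v ^+ 2.

(** Derivative along F_s in the first variable, in which t has the derivative [t1]; the [p00], ...,
    [p12] are second partial derivatives of u. *)
Definition dmultiplier (t b x1 x2 v a c d p00 p01 p02 p11 p12 : R) : R :=
  let t1 := x1 * b in
  (2 * t * t1 + 2 * x1) * a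
  + (t ^+ 2 + (x1 ^+ 2 + x2 ^+ 2)) * (p00 * t1 + p01)
  + 2 * t1 * (x1 * c + x2 * d)
  + 2 * t * (c + x1 * (p01 * t1 + p11) + x2 * (p02 * t1 + p12))
  + t1 * v + t * (a * t1 + c).

Definition dflux (t b j db x1 x2 v a c d p00 p01 p02 p11 p12 : R) : R :=
  let t1 := x1 * b in
  x1 * db * flux t x1 x2 v a c d
  + j * (- (dmultiplier t b x1 x2 v a c d p00 p01 p02 p11 p12 * c
            + multiplier t x1 x2 v a c d * (p01 * t1 + p11))
         + (t1 * x1 + t) * (c ^+ 2 + d ^+ 2 - a ^+ 2)
         + t * x1 * (2 * c * (p01 * t1 + p11) + 2 * d * (p02 * t1 + p12)
                     - 2 * a * (p00 * t1 + p01))).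

Definition ddensity (t b j db x1 x2 v a c d p00 p01 p02 p11 p12 p22 : R) : R :=
  j * multiplier t x1 x2 v a c d * (p00 - p11 - p22)
  - dflux t b j db x1 x2 v a c d p00 p01 p02 p11 p12
  - dflux t b j db x2 x1 v a d c p00 p02 p01 p22 p12.

Lemma is_derive_flux (t j v a c d : R -> R) (y x2 b db p00 p01 p02 p11 p12 : R) :
  is_derive y 1 t (y * b) -> is_derive y 1 j (y * db) ->
  is_derive y 1 v (a y * (y * b) + c y) ->
  is_derive y 1 a (p00 * (y * b) + p01) ->
  is_derive y 1 c (p01 * (y * b) + p11) ->
  is_derive y 1 d (p02 * (y * b) + p12) ->
  is_derive y 1
    (fun y => j y * flux (t y) y x2 (v y) (a y) (c y) (d y))
    (dflux (t y) b (j y) db y x2 (v y) (a y) (c y) (d y) p00 p01 p02 p11 p12).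
Proof.
move=> dt dj dv da dc dd.
rewrite /flux /multiplier; derive_eq; rewrite /dflux /dmultiplier /flux /multiplier /=.
ring.
Qed.

(* Piola form of the conservation law: on [F_s], pulled back to [x], the
   divergence of the current equals the [s]-derivative of its flux through
   [F_s] plus a tangential divergence. *)
Lemma is_derive_density (t b v a c d : R -> R) (s j db x1 x2 p00 p01 p02 p11 p12 p22 : R) :
  is_derive s 1 t j -> is_derive s 1 b db ->
  is_derive s 1 v (a s * j) -> is_derive s 1 a (p00 * j) ->
  is_derive s 1 c (p01 * j) -> is_derive s 1 d (p02 * j) ->
  is_derive s 1
    (fun s => density (t s) (b s) x1 x2 (v s) (a s) (c s) (d s))
    (ddensity (t s) (b s) j db x1 x2 (v s) (a s) (c s) (d s) p00 p01 p02 p11 p12 p22).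
Proof.
move=> dt db' dv da dc dd.
rewrite /density; derive_eq.
rewrite /ddensity /dflux /dmultiplier /flux /multiplier /=.
by field.
Qed.

(* In the null frame [p = ut + ur], [q = ut - ur] and with [beta = b r], this is
   Cauchy-Schwarz for
   [2 S = (t + r) ((t + r) p + u) + (t - r) ((t - r) q + u)] against the weights
   [1 + beta] and [1 - beta]; the last two terms of the right-hand side form
   the divergence of [x u^2] along [F_s]. *)
Lemma multiplier_bound (t b x1 x2 v a c d : R) :
  (1 - b ^+ 2 * (x1 ^+ 2 + x2 ^+ 2)) * multiplier t x1 x2 v a c d ^+ 2 <=
  (t ^+ 2 + (x1 ^+ 2 + x2 ^+ 2) - 2 * b * t * (x1 ^+ 2 + x2 ^+ 2)) *
  (2 * density t b x1 x2 v a c d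
   + ((v ^+ 2 + 2 * v * (x1 * (a * (x1 * b) + c)))
      + (v ^+ 2 + 2 * v * (x2 * (a * (x2 * b) + d))))).
Proof.
rewrite -subr_ge0; set D := _ - _.
(* After multiplication by r^2 the defect is a sum of two squares: one carries the rotational
   derivative x1 u_2 - x2 u_1, which the null frame does not see, and the other is the defect of the
   Cauchy-Schwarz inequality. *)
have E : (x1 ^+ 2 + x2 ^+ 2) * D =
    ((t ^+ 2 + (x1 ^+ 2 + x2 ^+ 2) - 2 * b * t * (x1 ^+ 2 + x2 ^+ 2))
     * (x1 * d - x2 * c)) ^+ 2
    + ((t ^+ 2 - (x1 ^+ 2 + x2 ^+ 2))
         * (x1 * c + x2 * d + b * (x1 ^+ 2 + x2 ^+ 2) * a)
       - v * (x1 ^+ 2 + x2 ^+ 2) * (1 - b * t)) ^+ 2.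
  by rewrite /D /multiplier /density; field.
(* At the origin the factor r^2 gives no information; there the defect is t^4 |grad u|^2. *)
have [/eqP|w0] := eqVneq (x1 ^+ 2 + x2 ^+ 2) 0; last first.
  have w1 : 0 < x1 ^+ 2 + x2 ^+ 2 by rewrite lt_def w0 addr_ge0 ?sqr_ge0.
  by rewrite -(pmulr_rge0 _ w1) E addr_ge0 ?sqr_ge0.
rewrite paddr_eq0 ?sqr_ge0 // !sqrf_eq0 => /andP[/eqP z1 /eqP z2].
have -> : D = (t ^+ 2) ^+ 2 * (c ^+ 2 + d ^+ 2).
  by rewrite /D /multiplier /density z1 z2; field.
by rewrite mulr_ge0 ?addr_ge0 ?sqr_ge0.
Qed.
End conformal_identity.

(** * Integrals over the slices *)

Section tame_integrals.
Variable R : realType.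
Variables s0 s1 : R.
Hypothesis s01 : s0 <= s1.
Implicit Types (f g : R -> R * R -> R).
Local Notation leb2 := (@lebesgue_measure R \x @lebesgue_measure R)%E.
Local Notation R2 := (measurableTypeR R * measurableTypeR R)%type.
Local Notation tame := (tame s0 s1).

Definition slice_integral f s : R := Rintegral leb2 [set: R2] (f s).

Lemma tame_integrable f s : tame (-4) f -> s0 <= s <= s1 ->
  leb2.-integrable [set: R2] (EFin \o f s).
Proof.
move=> tf sI; have [C fC] := tame_weight s01 tf; have [_ cf _] := tf.
by apply: (integrable_bounded_weight (C := C)) => [|x]; [exact: cf|exact: fC].
Qed.

Lemma EFin_slice_integral f s : tame (-4) f -> s0 <= s <= s1 ->
  (slice_integral f s)%:E = (\int[leb2]_x (f s x)%:E)%E.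
Proof.
by move=> tf sI; rewrite fineK //; apply: integrable_fin_num => //; exact: tame_integrable.
Qed.

Lemma integrable_cst_weight (C : R) :
  leb2.-integrable [set: R2] (EFin \o (fun x => C * weight x)).
Proof.
have : leb2.-integrable [set: R2] (fun x => (C%:E * (weight x)%:E)%E).
  by apply: integrableZl => //; exact: integrable_weight.
by [].
Qed.

Lemma slice_integral_continuous f : tame (-4) f ->
  {within `[s0, s1], continuous (slice_integral f)}.
Proof.
move=> tf; have [C fC] := tame_weight s01 tf; have [_ _ cf] := tf.
(* Continuity under the integral sign is available on an open interval, whereas [f] is controlled on
   [s0, s1] only; composing with the projection onto [s0, s1] extends it without affecting
   continuity. *)
pose cl (s : R) := Num.max s0 (Num.min s s1).
have clI s : s0 <= cl s <= s1.
  by rewrite /cl le_max lexx ge_max s01 ge_min lexx orbT.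
have clE s : s0 <= s <= s1 -> cl s = s.
  by move=> /andP[a b]; rewrite /cl min_l // max_r.
have ccl : continuous cl.
  move=> s; apply: (@continuous_max _ _ (cst s0) (fun s => Num.min s s1)).
    exact: cvg_cst.
  by apply: (@continuous_min _ _ id (cst s1)); [exact: cvg_id|exact: cvg_cst].
pose g s x := f (cl s) x.
apply: (@subspace_eq_continuous _ _ _ (fun s => Rintegral leb2 [set: R2] (g s))).
  by move=> s; rewrite inE /= in_itv /= => /clE; rewrite /g => ->.
apply: continuous_in_subspaceT => s; rewrite inE /= in_itv /= => /andP[ss0 ss1].
have int (z : R) : `]s0 - 1, s1 + 1[%classic z -> leb2.-integrable [set: R2] (EFin \o g z).
  by move=> _; exact: (tame_integrable tf (clI z)).
have cg : {ae leb2, forall y : R2, [set: R2] y ->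
    {in `]s0 - 1, s1 + 1[%classic, continuous (g ^~ y)}}.
  apply: aeW => x _ z _.
  exact: (@cvg_comp _ _ _ cl (f ^~ x) _ _ _ (ccl z) (cf _ x (clI z))).
have gub (z : R) : `]s0 - 1, s1 + 1[%classic z ->
    {ae leb2, forall y : R2, [set: R2] y -> `|g z y| <= C * weight y}.
  by move=> _; apply: aeW => x _; exact: fC.
apply: (continuity_under_integral measurableT int cg (integrable_cst_weight C) gub).
by rewrite inE /= in_itv /=; apply/andP; split; lra.
Qed.

Lemma slice_integral_is_derive f g s : tame (-4) f -> tame (-4) g ->
  (forall s x, s0 <= s <= s1 -> is_derive s 1 (f ^~ x) (g s x)) ->
  s0 < s < s1 -> is_derive s 1 (slice_integral f) (slice_integral g s).
Proof.
move=> tf tg dfg /andP[ss0 ss1]; have [C gC] := tame_weight s01 tg.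
have sI (z : R) : `]s0, s1[%classic z -> s0 <= z <= s1.
  by rewrite /= in_itv /= => /andP[a b]; rewrite !ltW.
have Is : `]s0, s1[%classic s by rewrite /= in_itv /= ss0.
have int x : `]s0, s1[%classic x -> leb2.-integrable [set: R2] (EFin \o f x).
  by move=> /sI; exact: tame_integrable.
have df (z : R) (y : R2) : `]s0, s1[%classic z -> [set: R2] y ->
    derivable (f ^~ y) z 1.
  by move=> /sI zI _; have [] := dfg z y zI.
have E (z : R) (y : R2) : `]s0, s1[%classic z -> partial1of2 (f : R -> R2 -> R) z y = g z y.
  by move=> /sI zI; rewrite partial1of2E; have [_ ->] := dfg z y zI.
have G0 (y : R2) : 0 <= C * weight y.
  by apply: le_trans (gC s y _) => //; rewrite !ltW.
have Gub (z : R) (y : R2) : `]s0, s1[%classic z -> [set: R2] y ->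
    `|partial1of2 (f : R -> R2 -> R) z y| <= C * weight y.
  by move=> zI _; rewrite E //; apply: gC; exact: sI.
have intG := integrable_cst_weight C.
apply: DeriveDef.
  exact: (derivable_under_integral measurableT Is int df G0 intG Gub).
rewrite -derive1E (differentiation_under_integral measurableT Is int df G0 intG Gub).
by apply: eq_Rintegral => y _; exact: E.
Qed.

Lemma slice_integral_derive1 (F f : R -> R * R -> R) s :
  tame (-4) F -> tame (-4) f -> s0 <= s <= s1 ->
  (forall x : R * R, is_derive x.1 1 (fun y => F s (y, x.2)) (f s x)) ->
  slice_integral f s = 0.
Proof.
move=> tF tf sI dF; have [C FC] := tame_weight s01 tF; have [D fD] := tame_weight s01 tf.
have [_ cf _] := tf; rewrite /slice_integral /Rintegral.
have wC (x : R * R) (c c' : R) : c <= c' -> c * weight x <= c' * weight x.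
  by move=> cc; rewrite ler_wpM2r // weight_ge0.
have b1 x : `|f s x| <= Num.max C D * weight x.
  by rewrite (le_trans (fD s x sI)) // wC // le_max lexx orbT.
have b2 x : `|F s x| <= Num.max C D * weight x.
  by rewrite (le_trans (FC s x sI)) // wC // le_max lexx.
by rewrite (@integral_plane_derive1 _ (F s) (f s) _ (cf s sI) (fun x y => dF (x, y)) b1 b2).
Qed.

Lemma slice_integral_derive2 (F f : R -> R * R -> R) s :
  tame (-4) F -> tame (-4) f -> s0 <= s <= s1 ->
  (forall x : R * R, is_derive x.2 1 (fun y => F s (x.1, y)) (f s x)) ->
  slice_integral f s = 0.
Proof.
move=> tF tf sI dF; have [C FC] := tame_weight s01 tF; have [D fD] := tame_weight s01 tf.
have [_ cf _] := tf; rewrite /slice_integral /Rintegral.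
have wC (x : R * R) (c c' : R) : c <= c' -> c * weight x <= c' * weight x.
  by move=> cc; rewrite ler_wpM2r // weight_ge0.
have b1 x : `|f s x| <= Num.max C D * weight x.
  by rewrite (le_trans (fD s x sI)) // wC // le_max lexx orbT.
have b2 x : `|F s x| <= Num.max C D * weight x.
  by rewrite (le_trans (FC s x sI)) // wC // le_max lexx.
by rewrite (@integral_plane_derive2 _ (F s) (f s) _ (cf s sI) (fun x y => dF (x, y)) b1 b2).
Qed.

Lemma slice_integralD f g s : tame (-4) f -> tame (-4) g -> s0 <= s <= s1 ->
  slice_integral (fun s x => f s x + g s x) s = slice_integral f s + slice_integral g s.
Proof. by move=> tf tg sI; apply: RintegralD => //; exact: tame_integrable. Qed.

Lemma slice_integralB f g s : tame (-4) f -> tame (-4) g -> s0 <= s <= s1 ->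
  slice_integral (fun s x => f s x - g s x) s = slice_integral f s - slice_integral g s.
Proof. by move=> tf tg sI; apply: RintegralB => //; exact: tame_integrable. Qed.

Lemma slice_integralZ (c : R) f s : tame (-4) f -> s0 <= s <= s1 ->
  slice_integral (fun s x => c * f s x) s = c * slice_integral f s.
Proof. by move=> tf sI; apply: RintegralZl => //; exact: tame_integrable. Qed.

Lemma slice_integral_ge0 f s : (forall x, 0 <= f s x) -> 0 <= slice_integral f s.
Proof. by move=> f0; apply: Rintegral_ge0 => x _; exact: f0. Qed.

Lemma le_slice_integral f g s : tame (-4) f -> tame (-4) g -> s0 <= s <= s1 ->
  (forall x, f s x <= g s x) -> slice_integral f s <= slice_integral g s.
Proof.
by move=> tf tg sI fg; apply: le_Rintegral => //; exact: tame_integrable.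
Qed.

End tame_integrals.

(** Assembles the order of an expression from the orders of its factors; that the result is at most
    -4 is then a computation with integers. *)
Ltac tame_auto s01 :=
  lazymatch goal with
  | |- tame _ _ _ (fun s x => @?f s x + @?g s x) =>
      refine (@tameD _ _ _ s01 _ _ f g _ _); tame_auto s01
  | |- tame _ _ _ (fun s x => - @?f s x) =>
      refine (@tameN _ _ _ _ f _); tame_auto s01
  | |- tame _ _ _ (fun s x => @?f s x * @?g s x) =>
      refine (@tameM _ _ _ _ _ f g _ _); tame_auto s01
  | |- tame _ _ _ (fun s x => @?f s x ^+ 2) =>
      refine (@tameX2 _ _ _ _ f _); tame_auto s01
  | |- tame _ _ _ (fun s x => x.1) => exact: tame_x1
  | |- tame _ _ _ (fun s x => x.2) => exact: tame_x2
  | H : tame _ _ _ ?t |- tame _ _ _ (fun s x => ?t s x) => exact H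
  | |- _ => refine (@tame_cst _ _ _ _)
  end.

(** * Orders of growth of the integrands *)

Section tame_energy.
Variable R : realType.
Variables s0 s1 : R.
Hypothesis s01 : s0 <= s1.
Local Notation tame := (tame s0 s1).
Variables t b j db v a c d p00 p01 p02 p11 p12 p22 : R -> R * R -> R.
Hypotheses (tt : tame 2 t) (tb : tame 0 b) (tj : tame 2 j) (tdb : tame 0 db)
  (tv : tame (-10) v) (ta : tame (-10) a) (tc : tame (-10) c) (td : tame (-10) d)
  (t00 : tame (-10) p00) (t01 : tame (-10) p01) (t02 : tame (-10) p02)
  (t11 : tame (-10) p11) (t12 : tame (-10) p12) (t22 : tame (-10) p22).

Lemma tame_density : tame (-4) (fun s x =>
  density (t s x) (b s x) x.1 x.2 (v s x) (a s x) (c s x) (d s x)).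
Proof.
by rewrite /density; eapply (tameW s01); last by tame_auto s01.
Qed.

Lemma tame_source_product : tame (-4) (fun s x =>
  j s x * multiplier (t s x) x.1 x.2 (v s x) (a s x) (c s x) (d s x)
  * (p00 s x - p11 s x - p22 s x)).
Proof.
by rewrite /multiplier; eapply (tameW s01); last by tame_auto s01.
Qed.

Lemma tame_flux1 : tame (-4) (fun s x =>
  j s x * flux (t s x) x.1 x.2 (v s x) (a s x) (c s x) (d s x)).
Proof.
by rewrite /flux /multiplier; eapply (tameW s01); last by tame_auto s01.
Qed.

Lemma tame_flux2 : tame (-4) (fun s x =>
  j s x * flux (t s x) x.2 x.1 (v s x) (a s x) (d s x) (c s x)).
Proof.
by rewrite /flux /multiplier; eapply (tameW s01); last by tame_auto s01.
Qed.

Lemma tame_dflux1 : tame (-4) (fun s x =>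
  dflux (t s x) (b s x) (j s x) (db s x) x.1 x.2 (v s x) (a s x) (c s x) (d s x)
    (p00 s x) (p01 s x) (p02 s x) (p11 s x) (p12 s x)).
Proof.
rewrite /dflux /dmultiplier /flux /multiplier.
by eapply (tameW s01); last by tame_auto s01.
Qed.

Lemma tame_dflux2 : tame (-4) (fun s x =>
  dflux (t s x) (b s x) (j s x) (db s x) x.2 x.1 (v s x) (a s x) (d s x) (c s x)
    (p00 s x) (p02 s x) (p01 s x) (p22 s x) (p12 s x)).
Proof.
rewrite /dflux /dmultiplier /flux /multiplier.
by eapply (tameW s01); last by tame_auto s01.
Qed.

Lemma tame_sqr1 : tame (-4) (fun s x => x.1 * v s x ^+ 2).
Proof. by eapply (tameW s01); last by tame_auto s01. Qed.

Lemma tame_sqr2 : tame (-4) (fun s x => x.2 * v s x ^+ 2).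
Proof. by eapply (tameW s01); last by tame_auto s01. Qed.

Lemma tame_dsqr1 : tame (-4) (fun s x =>
  v s x ^+ 2 + 2 * v s x * (x.1 * (a s x * (x.1 * b s x) + c s x))).
Proof. by eapply (tameW s01); last by tame_auto s01. Qed.

Lemma tame_dsqr2 : tame (-4) (fun s x =>
  v s x ^+ 2 + 2 * v s x * (x.2 * (a s x * (x.2 * b s x) + d s x))).
Proof. by eapply (tameW s01); last by tame_auto s01. Qed.

(** The most demanding integrand: the factors contribute 4 + 2 + 4 - 20 = -10. *)
Lemma tame_source_sqr (z : R -> R * R -> R) : tame 2 z -> tame (-4) (fun s x =>
  j s x ^+ 2 * z s x *
  (t s x ^+ 2 + (x.1 ^+ 2 + x.2 ^+ 2) - 2 * b s x * t s x * (x.1 ^+ 2 + x.2 ^+ 2))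
  * (p00 s x - p11 s x - p22 s x) ^+ 2).
Proof. by move=> tz; eapply (tameW s01); last by tame_auto s01. Qed.

End tame_energy.

(** * The conformal energy *)

Lemma partial_sym (R : realType) (U : set (spacetime R)) (u : spacetime R -> R) i j p :
  open U -> C2_on U u -> U p ->
  partial i (partial j u) p = partial j (partial i u) p.
Proof.
move=> oU [_ d1 _ d2 c2] Up; apply: (derive_sym oU Up) => [q Uq|q Uq|q Uq|q Uq||].
- exact: d1.
- exact: d1.
- exact: d2.
- exact: d2.
- by apply: c2; rewrite inE.
- by apply: c2; rewrite inE.
Qed.

(* Young's inequality in disguise; [z] stands for [1 / zeta^2]. *)
Lemma source_young (R : realType) (j S B z A Q l : R) :
  0 < z -> 0 < A -> S ^+ 2 <= z * A * Q -> 0 < l ->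
  2 * l * (j * S * B) <= l ^+ 2 * Q + j ^+ 2 * z * A * B ^+ 2.
Proof.
move=> z0 A0 SQ l0.
have zA : 0 < z * A by rewrite mulr_gt0.
have Q1 : S ^+ 2 / (z * A) <= Q by rewrite ler_pdivrMr // mulrC.
have h : l ^+ 2 * (S ^+ 2 / (z * A)) <= l ^+ 2 * Q by rewrite ler_wpM2l // sqr_ge0.
apply: le_trans (lerD h (lexx _)).
rewrite -subr_ge0.
have -> : l ^+ 2 * (S ^+ 2 / (z * A)) + j ^+ 2 * z * A * B ^+ 2 - 2 * l * (j * S * B)
  = (l * S - j * B * (z * A)) ^+ 2 / (z * A).
  by field; rewrite !gt_eqF.
by rewrite divr_ge0 ?sqr_ge0 // ltW.
Qed.

(** With y = x^a and f = u along a leaf, this is one term of the tangential divergence of x u^2. *)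
Lemma is_derive_weighted_sqr (R : realType) (f : R -> R) (y d : R) :
  is_derive y 1 f d ->
  is_derive y 1 (fun y => y * f y ^+ 2) (f y ^+ 2 + 2 * f y * (y * d)).
Proof. by move=> df; derive_eq; rewrite /=; ring. Qed.

Lemma sub_zeros (R : zmodType) (x y z : R) : y = 0 -> z = 0 -> x = x - y - z.
Proof. by move=> -> ->; rewrite !subr0. Qed.

Lemma add_zeros (R : zmodType) (x y z : R) : y = 0 -> z = 0 -> x + (y + z) = x.
Proof. by move=> -> ->; rewrite !addr0. Qed.

Section energy.
Variables (R : realType) (chi : R -> R).
Hypothesis cchi : cutoff chi.
Variables s0 s1 : R.
Hypothesis s0_ge2 : 2 <= s0.
Hypothesis s01 : s0 <= s1.
Variables (U : set (spacetime R)) (u : spacetime R -> R).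
Hypothesis oU : open U.
Hypothesis slU : forall s x, s0 <= s <= s1 -> U (sl chi s x).
Hypothesis Cu : C2_on U u.
Variable C0 : R.
Hypothesis u_decay : forall s x, s0 <= s <= s1 ->
  [/\ `|u (sl chi s x)| <= C0 * japanese x ^- 10,
      forall i, `|partial i u (sl chi s x)| <= C0 * japanese x ^- 10 &
      forall i j, `|partial j (partial i u) (sl chi s x)| <= C0 * japanese x ^- 10].
Local Notation tame := (tame s0 s1).
Implicit Types (s : R) (x : R * R).

Definition on_slice (f : spacetime R -> R) s x : R := f (sl chi s x).
Local Notation t := (tF chi).
Local Notation b := (bF chi).
Local Notation j := (jF chi).
Local Notation db := (dbF chi).
Local Notation v := (on_slice u).
Local Notation d1 i := (on_slice (partial i u)).
Local Notation d2 i k := (on_slice (partial k (partial i u))).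

Let tt : tame 2 t := tame_t cchi s1 s0_ge2.
Let tb : tame 0 b := tame_b cchi s1 s0_ge2.
Let tj : tame 2 j := tame_j cchi s1 s0_ge2.
Let tdb : tame 0 db := tame_db cchi s1 s0_ge2.

Let tv : tame (-10) v.
Proof.
apply: (tame_field cchi s0_ge2 slU (m := 10) (C := C0)); first by case: Cu.
by move=> s x /(@u_decay _ x)[].
Qed.

Let td1 i : tame (-10) (d1 i).
Proof.
apply: (tame_field cchi s0_ge2 slU (m := 10) (C := C0)); first by case: Cu.
by move=> s x /(@u_decay _ x)[].
Qed.

Let td2 i k : tame (-10) (d2 i k).
Proof.
apply: (tame_field cchi s0_ge2 slU (m := 10) (C := C0)); first by case: Cu.
by move=> s x /(@u_decay _ x)[].
Qed.

Definition energy_density s x : R :=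
  density (t s x) (b s x) x.1 x.2 (v s x) (d1 0 s x) (d1 1 s x) (d1 2%:R s x).

Definition energy_source s x : R :=
  j s x * multiplier (t s x) x.1 x.2 (v s x) (d1 0 s x) (d1 1 s x) (d1 2%:R s x)
  * (d2 0 0 s x - d2 1 1 s x - d2 2%:R 2%:R s x).

(** The square of J zeta^-1 A^(1/2) Box u, written without roots so that its order and continuity
    follow from those of its factors. *)
Definition source_sqr s x : R :=
  j s x ^+ 2 * (1 - b s x ^+ 2 * sqn x)^-1 *
  (t s x ^+ 2 + (x.1 ^+ 2 + x.2 ^+ 2) - 2 * b s x * t s x * (x.1 ^+ 2 + x.2 ^+ 2))
  * (d2 0 0 s x - d2 1 1 s x - d2 2%:R 2%:R s x) ^+ 2.

Let dflux1 s x : R :=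
  dflux (t s x) (b s x) (j s x) (db s x) x.1 x.2 (v s x) (d1 0 s x) (d1 1 s x)
    (d1 2%:R s x) (d2 0 0 s x) (d2 0 1 s x) (d2 0 2%:R s x) (d2 1 1 s x) (d2 1 2%:R s x).

Let dflux2 s x : R :=
  dflux (t s x) (b s x) (j s x) (db s x) x.2 x.1 (v s x) (d1 0 s x) (d1 2%:R s x)
    (d1 1 s x) (d2 0 0 s x) (d2 0 2%:R s x) (d2 0 1 s x) (d2 2%:R 2%:R s x) (d2 1 2%:R s x).

Let dsqr1 s x : R :=
  v s x ^+ 2 + 2 * v s x * (x.1 * (d1 0 s x * (x.1 * b s x) + d1 1 s x)).
Let dsqr2 s x : R :=
  v s x ^+ 2 + 2 * v s x * (x.2 * (d1 0 s x * (x.2 * b s x) + d1 2%:R s x)).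

Lemma tame_energy_density : tame (-4) energy_density.
Proof. exact: (tame_density s01 tt tb tv (td1 0) (td1 1) (td1 2%:R)). Qed.

Lemma tame_energy_source : tame (-4) energy_source.
Proof.
exact: (tame_source_product s01 tt tj tv (td1 0) (td1 1) (td1 2%:R)
  (td2 0 0) (td2 1 1) (td2 2%:R 2%:R)).
Qed.

Lemma tame_energy_source_sqr : tame (-4) source_sqr.
Proof.
exact: (tame_source_sqr s01 tt tb tj (td2 0 0) (td2 1 1) (td2 2%:R 2%:R)
  (tame_inv_zeta2 cchi s1 s0_ge2)).
Qed.

Let tame_dflux1' : tame (-4) dflux1.
Proof.
exact: (tame_dflux1 s01 tt tb tj tdb tv (td1 0) (td1 1) (td1 2%:R)
  (td2 0 0) (td2 0 1) (td2 0 2%:R) (td2 1 1) (td2 1 2%:R)).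
Qed.

Let tame_dflux2' : tame (-4) dflux2.
Proof.
exact: (tame_dflux2 s01 tt tb tj tdb tv (td1 0) (td1 1) (td1 2%:R)
  (td2 0 0) (td2 0 1) (td2 0 2%:R) (td2 1 2%:R) (td2 2%:R 2%:R)).
Qed.

Let deriv_s (f : spacetime R -> R) s x :
  (forall i p, U p -> derivable f p (@dir R i)) ->
  (forall i, {in U, continuous (partial i f)}) -> s0 <= s <= s1 ->
  is_derive s 1 (on_slice f ^~ x) (partial 0 f (sl chi s x) * j s x).
Proof. by move=> df cf sI; exact: (is_derive_field_s cchi s0_ge2 oU slU df cf x sI). Qed.

(** Differentiating a first derivative of u along a leaf produces the mixed derivatives in either
    order, while the algebraic identities have a single symbol for both. *)
Let mixed i k s x : s0 <= s <= s1 ->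
  partial i (partial k u) (sl chi s x) = d2 i k s x.
Proof. by move=> sI; apply: partial_sym oU Cu _; exact: slU. Qed.

Lemma is_derive_energy_density s x : s0 <= s <= s1 ->
  is_derive s 1 (energy_density ^~ x) (energy_source s x - dflux1 s x - dflux2 s x).
Proof.
move=> sI; case: (Cu) => _ d1u c1u d2u c2u.
have dt := is_derive_tF_s cchi s0_ge2 x sI.
have db' := is_derive_bF_s cchi s0_ge2 x sI.
have dv := deriv_s x d1u c1u sI.
have dd i : is_derive s 1 (d1 i ^~ x) (d2 0 i s x * j s x).
  have := deriv_s x (d2u i) (c2u i) sI.
  by rewrite mixed.
exact: (is_derive_density x.1 x.2 (d2 1 1 s x) (d2 1 2%:R s x) (d2 2%:R 2%:R s x)
  dt db' dv (dd 0) (dd 1) (dd 2%:R)).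
Qed.

Let integral_dflux1 s : s0 <= s <= s1 -> slice_integral dflux1 s = 0.
Proof.
move=> sI; case: (Cu) => _ d1u c1u d2u c2u.
apply: (slice_integral_derive1 s01 (tame_flux1 s01 tt tj tv (td1 0) (td1 1) (td1 2%:R))
  tame_dflux1' sI) => -[x1 x2].
have [dt _] := is_derive_tF_x cchi s0_ge2 (x1, x2) sI.
have [dj _] := is_derive_jF_x cchi s0_ge2 (x1, x2) sI.
have [dv _] := is_derive_field_x cchi s0_ge2 oU slU d1u c1u (x1, x2) sI.
have dd i : is_derive x1 1 (fun y => d1 i s (y, x2))
    (d2 0 i s (x1, x2) * (x1 * b s (x1, x2)) + partial 1 (partial i u) (sl chi s (x1, x2))).
  have [+ _] := is_derive_field_x cchi s0_ge2 oU slU (d2u i) (c2u i) (x1, x2) sI.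
  by rewrite (mixed 0 i).
have dd2 := derive_ext (dd 2%:R) (congr1 _ (mixed 1 2%:R (x1, x2) sI)).
exact: (is_derive_flux x2 dt dj dv (dd 0) (dd 1) dd2).
Qed.

Let integral_dflux2 s : s0 <= s <= s1 -> slice_integral dflux2 s = 0.
Proof.
move=> sI; case: (Cu) => _ d1u c1u d2u c2u.
apply: (slice_integral_derive2 s01 (tame_flux2 s01 tt tj tv (td1 0) (td1 1) (td1 2%:R))
  tame_dflux2' sI) => -[x1 x2].
have [_ dt] := is_derive_tF_x cchi s0_ge2 (x1, x2) sI.
have [_ dj] := is_derive_jF_x cchi s0_ge2 (x1, x2) sI.
have [_ dv] := is_derive_field_x cchi s0_ge2 oU slU d1u c1u (x1, x2) sI.
have dd i : is_derive x2 1 (fun y => d1 i s (x1, y))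
    (d2 0 i s (x1, x2) * (x2 * b s (x1, x2)) + partial 2%:R (partial i u) (sl chi s (x1, x2))).
  have [_] := is_derive_field_x cchi s0_ge2 oU slU (d2u i) (c2u i) (x1, x2) sI.
  by rewrite (mixed 0 i).
exact: (is_derive_flux x1 dt dj dv (dd 0) (dd 2%:R) (dd 1)).
Qed.

Definition energy s : R := slice_integral energy_density s.

Lemma is_derive_energy s : s0 < s < s1 ->
  is_derive s 1 energy (slice_integral energy_source s).
Proof.
move=> sI; have sI' : s0 <= s <= s1 by case/andP: sI => *; rewrite !ltW.
have t1 : tame (-4) (fun s x => energy_source s x - dflux1 s x).
  exact: (tameD s01 tame_energy_source (tameN tame_dflux1')).
have t2 : tame (-4) (fun s x => energy_source s x - dflux1 s x - dflux2 s x).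
  exact: (tameD s01 t1 (tameN tame_dflux2')).
have -> : slice_integral energy_source s =
    slice_integral (fun s x => energy_source s x - dflux1 s x - dflux2 s x) s.
  rewrite (slice_integralB s01 t1 tame_dflux2' sI').
  rewrite (slice_integralB s01 tame_energy_source tame_dflux1' sI').
  exact: (sub_zeros _ (integral_dflux1 sI') (integral_dflux2 sI')).
exact: (slice_integral_is_derive s01 tame_energy_density t2 is_derive_energy_density sI).
Qed.

Let integral_dsqr1 s : s0 <= s <= s1 -> slice_integral dsqr1 s = 0.
Proof.
move=> sI; case: (Cu) => _ d1u c1u d2u c2u.
apply: (slice_integral_derive1 s01 (tame_sqr1 s01 tv)
  (tame_dsqr1 s01 tb tv (td1 0) (td1 1)) sI) => -[x1 x2].
have [dv _] := is_derive_field_x cchi s0_ge2 oU slU d1u c1u (x1, x2) sI.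
exact: (is_derive_weighted_sqr dv).
Qed.

Let integral_dsqr2 s : s0 <= s <= s1 -> slice_integral dsqr2 s = 0.
Proof.
move=> sI; case: (Cu) => _ d1u c1u d2u c2u.
apply: (slice_integral_derive2 s01 (tame_sqr2 s01 tv)
  (tame_dsqr2 s01 tb tv (td1 0) (td1 2%:R)) sI) => -[x1 x2].
have [_ dv] := is_derive_field_x cchi s0_ge2 oU slU d1u c1u (x1, x2) sI.
exact: (is_derive_weighted_sqr dv).
Qed.

(* Differs from [2 * energy_density] by a tangential divergence, and unlike it
   is pointwise nonnegative. *)
Definition coercive_density s x : R :=
  2 * energy_density s x + (dsqr1 s x + dsqr2 s x).

Let tame_coercive : tame (-4) coercive_density.
Proof.
have t1 := tame_dsqr1 s01 tb tv (td1 0) (td1 1).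
have t2 := tame_dsqr2 s01 tb tv (td1 0) (td1 2%:R).
exact: (tameD s01 (tameM (tame_cst s0 s1 2) tame_energy_density) (tameD s01 t1 t2)).
Qed.

Lemma integral_coercive_density s : s0 <= s <= s1 ->
  slice_integral coercive_density s = 2 * energy s.
Proof.
move=> sI.
have t1 := tame_dsqr1 s01 tb tv (td1 0) (td1 1).
have t2 := tame_dsqr2 s01 tb tv (td1 0) (td1 2%:R).
have t3 := tameM (tame_cst s0 s1 2) tame_energy_density.
rewrite (slice_integralD s01 t3 (tameD s01 t1 t2) sI).
rewrite (slice_integralD s01 t1 t2 sI).
apply: etrans (add_zeros _ (integral_dsqr1 sI) (integral_dsqr2 sI)) _.
exact: (slice_integralZ s01 2 tame_energy_density sI).
Qed.

Definition coefA_slice s x : R :=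
  t s x ^+ 2 + (x.1 ^+ 2 + x.2 ^+ 2) - 2 * b s x * t s x * (x.1 ^+ 2 + x.2 ^+ 2).

(** Completing the square gives A = (t - b r^2)^2 + r^2 zeta^2. The second term is positive away
    from the origin, and at the origin t = s > 0. *)
Lemma coefA_slice_gt0 s x : s0 <= s <= s1 -> 0 < coefA_slice s x.
Proof.
move=> sI; have z0 := zeta2_gt0 cchi s0_ge2 x sI.
have -> : coefA_slice s x =
    (t s x - b s x * sqn x) ^+ 2 + sqn x * (1 - b s x ^+ 2 * sqn x).
  by rewrite /coefA_slice /sqn; ring.
have [w0|w0] := eqVneq (sqn x) 0.
  rewrite w0 mul0r mulr0 subr0 addr0 exprn_gt0 // /tF w0 Th0 //.
    by case/andP: sI => + _; have := s0_ge2; lra.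
  exact: (sI_gt s0_ge2 sI).
have w1 : 0 < sqn x by rewrite lt_def w0 sqn_ge0.
by rewrite ltr_wpDl ?sqr_ge0 // mulr_gt0.
Qed.

Let multiplier_slice s x : R :=
  multiplier (t s x) x.1 x.2 (v s x) (d1 0 s x) (d1 1 s x) (d1 2%:R s x).

Lemma sqr_multiplier_le s x : s0 <= s <= s1 ->
  multiplier_slice s x ^+ 2 <=
  (1 - b s x ^+ 2 * sqn x)^-1 * coefA_slice s x * coercive_density s x.
Proof.
move=> sI; have z0 := zeta2_gt0 cchi s0_ge2 x sI.
rewrite -mulrA ler_pdivlMl //.
exact: (multiplier_bound (t s x) (b s x) x.1 x.2 (v s x) (d1 0 s x) (d1 1 s x) (d1 2%:R s x)).
Qed.

(** Its product with the positive factor A / zeta^2 dominates a square. *)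
Lemma coercive_density_ge0 s x : s0 <= s <= s1 -> 0 <= coercive_density s x.
Proof.
move=> sI; have z0 := zeta2_gt0 cchi s0_ge2 x sI.
have A0 := coefA_slice_gt0 x sI.
have zA : 0 < (1 - b s x ^+ 2 * sqn x)^-1 * coefA_slice s x.
  by rewrite mulr_gt0 // invr_gt0.
rewrite -(pmulr_rge0 _ zA); apply: le_trans (sqr_multiplier_le x sI).
exact: sqr_ge0.
Qed.

Lemma energy_ge0 s : s0 <= s <= s1 -> 0 <= energy s.
Proof.
move=> sI; have : 0 <= 2 * energy s.
  rewrite -integral_coercive_density //; apply: slice_integral_ge0 => x.
  exact: coercive_density_ge0.
by rewrite pmulr_rge0.
Qed.

Definition source_norm2 s : R := slice_integral source_sqr s.

Lemma source_sqr_ge0 s x : s0 <= s <= s1 -> 0 <= source_sqr s x.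
Proof.
move=> sI; have z0 := zeta2_gt0 cchi s0_ge2 x sI.
have A0 := coefA_slice_gt0 x sI; rewrite /source_sqr -/(coefA_slice s x).
have z1 : 0 <= (1 - b s x ^+ 2 * sqn x)^-1 by rewrite invr_ge0 ltW.
by apply: mulr_ge0; [apply: mulr_ge0; [apply: mulr_ge0|exact: ltW]|]; rewrite ?sqr_ge0.
Qed.

Lemma source_norm2_ge0 s : s0 <= s <= s1 -> 0 <= source_norm2 s.
Proof. by move=> sI; apply: slice_integral_ge0 => x; exact: source_sqr_ge0. Qed.

(** Young's inequality with a free parameter, integrated pointwise, takes the place of the
    Cauchy-Schwarz inequality for integrals, which a choice of [l] recovers. The coefficient 2 of
    the energy is the one in the integral of [coercive_density]. *)
Lemma energy_source_bound s (l : R) : s0 <= s <= s1 -> 0 < l ->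
  2 * l * slice_integral energy_source s <= 2 * l ^+ 2 * energy s + source_norm2 s.
Proof.
move=> sI l0.
have tl := tameM (tame_cst s0 s1 (l ^+ 2)) tame_coercive.
have -> : 2 * l ^+ 2 * energy s = slice_integral (fun s x => l ^+ 2 * coercive_density s x) s.
  by rewrite (slice_integralZ s01 _ tame_coercive sI) integral_coercive_density //
      [RHS]mulrCA mulrA.
rewrite /source_norm2 -(slice_integralD s01 tl tame_energy_source_sqr sI).
rewrite -(slice_integralZ s01 (2 * l) tame_energy_source sI).
apply: (le_slice_integral s01 (tameM (tame_cst s0 s1 (2 * l)) tame_energy_source)
  (tameD s01 tl tame_energy_source_sqr) sI) => x.
have z0 := zeta2_gt0 cchi s0_ge2 x sI.
apply: source_young => //; first by rewrite invr_gt0.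
- exact: coefA_slice_gt0.
- exact: sqr_multiplier_le.
Qed.

Lemma energy_continuous : {within `[s0, s1], continuous energy}.
Proof. exact: (slice_integral_continuous s01 tame_energy_density). Qed.

Lemma source_norm2_continuous : {within `[s0, s1], continuous source_norm2}.
Proof. exact: (slice_integral_continuous s01 tame_energy_source_sqr). Qed.

End energy.

(** * Growth of the square root of the energy *)

Lemma continuous_within_comp (R : realType) (A : set R) (f g : R -> R) :
  {within A, continuous f} -> continuous g ->
  {within A, continuous (fun x => g (f x))}.
Proof. by move=> cf cg s; exact: (cvg_comp _ _ (@cf s) (@cg (f s))). Qed.

Section growth.
Variable R : realType.
Local Notation leb := (@lebesgue_measure R).
Variables (s0 s1 : R) (E G N : R -> R).
Hypothesis s01 : s0 < s1.
Hypothesis dE : forall s : R, s0 < s < s1 -> is_derive s 1 E (G s).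
Hypothesis cE : {within `[s0, s1], continuous E}.
Hypothesis cN : {within `[s0, s1], continuous N}.
Hypothesis E_ge0 : forall s : R, s0 <= s <= s1 -> 0 <= E s.
Hypothesis N_ge0 : forall s : R, s0 <= s <= s1 -> 0 <= N s.
Hypothesis G_le : forall s l : R, s0 <= s <= s1 -> 0 < l ->
  2 * l * G s <= 2 * l ^+ 2 * E s + N s.

Let root2 : R := Num.sqrt 2.

(** The left side is the derivative of (E + e)^(1/2). Adding [e] makes the root differentiable where
    E vanishes, and the bound is independent of [e]. *)
Let derivative_bound (e s : R) : 0 < e -> s0 <= s <= s1 ->
  (2 * Num.sqrt (E s + e))^-1 * G s <= root2 / 2 * Num.sqrt (N s).
Proof.
move=> e0 sI; have E0 := E_ge0 sI; have N0 := N_ge0 sI.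
have Ee : 0 < E s + e by rewrite ltr_wpDl.
set Y := Num.sqrt _; have Y0 : 0 < Y by rewrite sqrtr_gt0.
have Y2 : Y ^+ 2 = E s + e by rewrite sqr_sqrtr // ltW.
have n0 : 0 <= Num.sqrt (N s) := sqrtr_ge0 _.
have n2 : Num.sqrt (N s) ^+ 2 = N s by rewrite sqr_sqrtr.
have r0 : 0 < root2 by rewrite sqrtr_gt0.
have r2 : root2 ^+ 2 = 2 by rewrite sqr_sqrtr.
have GY : G s <= root2 * Y * Num.sqrt (N s).
  have [G0|G0] := leP (G s) 0.
    by rewrite (le_trans G0) // !mulr_ge0 // ltW.
  (* With this [l] the left side of [G_le] is G^2 / Y^2 and the energy term at most half of it,
     which leaves G^2 / Y^2 <= 2 N. Neither E nor N, which may vanish, occurs as a denominator. *)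
  have l0 : 0 < G s / (2 * Y ^+ 2) by rewrite divr_gt0 // mulr_gt0 // exprn_gt0.
  have := G_le sI l0.
  have -> : 2 * (G s / (2 * Y ^+ 2)) * G s = G s ^+ 2 / Y ^+ 2.
    by field; rewrite gt_eqF.
  have -> : 2 * (G s / (2 * Y ^+ 2)) ^+ 2 * E s = (G s ^+ 2 / Y ^+ 2) * (E s / (2 * Y ^+ 2)).
    by field; rewrite gt_eqF.
  have k : E s / (2 * Y ^+ 2) <= 2^-1.
    by rewrite Y2 ler_pdivrMr ?mulr_gt0 // mulrA mulVf ?mul1r // lerDl ltW.
  have q0 : 0 <= G s ^+ 2 / Y ^+ 2 by rewrite divr_ge0 ?sqr_ge0.
  have := ler_wpM2l q0 k; set q := G s ^+ 2 / Y ^+ 2 => k1 k2.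
  have q1 : q <= 2 * N s by lra.
  have rhs0 : 0 <= root2 * Y * Num.sqrt (N s) by rewrite !mulr_ge0 // ltW.
  rewrite -(@ler_pXn2r _ 2%N) ?nnegrE ?(ltW G0) // !exprMn r2 n2.
  by rewrite (mulrAC 2) -ler_pdivrMr ?exprn_gt0.
have -> : (2 * Y)^-1 * G s = G s / (2 * Y) by rewrite mulrC.
rewrite ler_pdivrMr ?mulr_gt0 //.
have -> : root2 / 2 * Num.sqrt (N s) * (2 * Y) = root2 * Y * Num.sqrt (N s) by field.
by [].
Qed.

Let n s : R := Num.sqrt (N s).
Let intn s : R := \int[leb]_(t in `[s0, s]%classic) n t.

Lemma sqrt_norm_continuous : {within `[s0, s1], continuous n}.
Proof.
exact: continuous_within_comp cN (@sqrt_continuous R).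
Qed.

Lemma sqrt_norm_integrable : leb.-integrable `[s0, s1] (EFin \o n).
Proof.
by apply: continuous_compact_integrable; [exact: segment_compact|exact: sqrt_norm_continuous].
Qed.

Let growth_regularized (e : R) : 0 < e ->
  Num.sqrt (E s1 + e) <= Num.sqrt (E s0 + e) + root2 / 2 * intn s1.
Proof.
move=> e0; have s01' := ltW s01.
pose D s := root2 / 2 * intn s - Num.sqrt (E s + e).
have [cn _ _] := (continuous_within_itvP n s01).1 sqrt_norm_continuous.
have dD (s : R) : s \in `]s0, s1[ ->
    is_derive s 1 D (root2 / 2 * n s - (2 * Num.sqrt (E s + e))^-1 * G s).
  move=> sI; have := sI; rewrite in_itv /= => /andP[ss0 ss1].
  have [di di'] := continuous_FTC1_closed ss1 sqrt_norm_integrable ss0 (cn s sI).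
  have d1 : is_derive s 1 intn (n s) by apply: DeriveDef; [exact: di|rewrite -derive1E; exact: di'].
  have d2 := dE (s := s) ltac:(by rewrite ss0).
  have d3 : is_derive s 1 (fun s => E s + e) (G s).
    by derive_eq; rewrite addr0.
  have Ee : 0 < E s + e by rewrite ltr_wpDl // E_ge0 // !ltW.
  have d4 := @is_derive1_comp R (@Num.sqrt R) (fun s => E s + e) s _ _ (is_derive1_sqrt Ee) d3.
  have {}d4 : is_derive s 1 (fun s => Num.sqrt (E s + e)) _ := d4.
  by rewrite /D; derive_eq; rewrite mulr0 addr0.
have cD : {within `[s0, s1], continuous D}.
  have c1 : {within `[s0, s1], continuous intn}.
    exact: (parameterized_integral_continuous s01' sqrt_norm_integrable).
  have c2 : {within `[s0, s1], continuous (fun s => Num.sqrt (E s + e))}.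
    apply: (continuous_within_comp (g := fun y => Num.sqrt (y + e)) cE) => y.
    apply: (@cvg_comp _ _ _ (fun y => y + e) Num.sqrt); last exact: sqrt_continuous.
    by apply: cvgD; [exact: cvg_id|exact: cvg_cst].
  move=> s; apply: cvgB; last exact: c2.
  by apply: cvgM; [exact: cvg_cst|exact: c1].
have [c + eq] := MVT_segment s01' dD cD.
rewrite in_itv /= => cI.
have : 0 <= D s1 - D s0.
  rewrite eq mulr_ge0 ?subr_ge0 //; exact: derivative_bound.
have -> : D s0 = - Num.sqrt (E s0 + e).
  by rewrite /D /intn set_itv1 Rintegral_set1 mulr0 sub0r.
by rewrite /D; lra.
Qed.

Lemma sqrt_growth :
  Num.sqrt (E s1) <= Num.sqrt (E s0) + root2 / 2 * intn s1.
Proof.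
have s01' := ltW s01.
apply/ler_addgt0Pr => e e0.
have E0 : 0 <= E s0 by rewrite E_ge0 // lexx.
have E1 : 0 <= E s1 by rewrite E_ge0 // lexx s01'.
(* Regularizing by e^2 costs at most [e], as (E + e^2)^(1/2) <= E^(1/2) + e. *)
have e2 : 0 < e ^+ 2 by rewrite exprn_gt0.
have h1 : Num.sqrt (E s1) <= Num.sqrt (E s1 + e ^+ 2).
  by rewrite ler_sqrt ?lerDl ?ltW // ltr_wpDl.
have h2 : Num.sqrt (E s0 + e ^+ 2) <= Num.sqrt (E s0) + e.
  have q := sqrtr_ge0 (E s0).
  have pe : 0 <= Num.sqrt (E s0) + e by rewrite addr_ge0 // ltW.
  rewrite -[leRHS](ger0_norm pe) -sqrtr_sqr ler_sqrt ?sqr_ge0 //.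
  by rewrite sqrrD sqr_sqrtr // lerD2r lerDl mulrn_wge0 // mulr_ge0 // ltW.
by have := growth_regularized e2; lra.
Qed.

End growth.

(** * The energy estimate *)

Lemma polar_cancel (R : fieldType) (r x y a c : R) :
  r != 0 -> r * (x / r * a + y / r * c) = x * a + y * c.
Proof. by move=> r0; field. Qed.

Lemma sqr_quotient (R : fieldType) (a b c d : R) :
  (a * b^-1 * c * d) ^+ 2 = a ^+ 2 * (b ^+ 2)^-1 * c ^+ 2 * d ^+ 2.
Proof. by rewrite !exprMn exprVn. Qed.

Lemma polar_zero (R : fieldType) (a c : R) :
  0 * (0 / 0 * a + 0 / 0 * c) = 0 * a + 0 * c.
Proof. by rewrite !mul0r addr0. Qed.

Lemma sqr_norm_powR (R : realType) (y : R) : `|y| `^ 2 = y ^+ 2.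
Proof. by rewrite powR_mulrn ?normr_ge0 // real_normK ?num_real. Qed.

(** * Translation between the stated quantities and the explicit ones *)

Section conclusion.
Variables (R : realType) (chi : R -> R) (T : R -> R -> R).
Hypothesis cchi : cutoff chi.
Hypothesis Ttime : time_function chi T.
Variables (s0 s1 : R) (u : spacetime R -> R).
Hypothesis s0_ge2 : 2 <= s0.
Hypothesis s01 : s0 <= s1.
Local Notation leb := (@lebesgue_measure R).
Local Notation leb2 := (@lebesgue_measure R \x @lebesgue_measure R)%E.
Implicit Types (s : R) (x : R * R).

Lemma sqr_radius_sqn x : radius x ^+ 2 = sqn x.
Proof. exact: sqr_radius. Qed.

Lemma sliceE s x : s0 <= s <= s1 -> slice T s x = sl chi s x.
Proof.
move=> /andP[ss _]; rewrite /slice /sl /tF (time_functionE cchi Ttime) ?sqr_radius_sqn //.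
- exact: le_trans ss.
- exact: radius_ge0.
Qed.

(** Monotonicity of [Th] in [s]. This is how the regularity and decay assumed on the slab reach
    every leaf. *)
Lemma sl_slab s x : s0 <= s <= s1 -> slab T s0 s1 (sl chi s x).
Proof.
move=> sI; have /andP[a b] := sI.
have s3 := sI_gt s0_ge2 sI; have w1 := sqn_geN1 x.
rewrite /slab /= !(time_functionE cchi Ttime) ?radius_ge0 ?(le_trans s0_ge2) //.
rewrite sqr_radius_sqn /tF !Th_le //.
by apply: (sI_gt s0_ge2 (s1 := s1)); rewrite lexx.
Qed.

(** At the origin both sides are 0, the left one through 0^-1 = 0; the energy density is thus free
    of the singular factor x / r. *)
Lemma sqr_radius_partial_r (p : spacetime R) :
  radius p.2 * partial_r u p = p.2.1 * partial 1 u p + p.2.2 * partial 2%:R u p.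
Proof.
rewrite /partial_r; have [r0|r0] := eqVneq (radius p.2) 0; last exact: polar_cancel.
have := sqr_radius p.2; rewrite r0 expr0n /= => /esym/eqP.
rewrite paddr_eq0 ?sqr_ge0 // !sqrf_eq0 => /andP[/eqP -> /eqP ->].
exact: polar_zero.
Qed.

Lemma xi_bF s x : xi chi s (radius x) / Num.sqrt (s ^+ 2 + radius x ^+ 2) = bF chi s x.
Proof. by rewrite xi_slope ?radius_ge0 // sqr_radius_sqn. Qed.

Lemma econE s x : s0 <= s <= s1 ->
  econ chi s u (slice T s x) = energy_density chi u s x.
Proof.
move=> sI; rewrite sliceE // /econ /energy_density /density /on_slice.
by rewrite sqr_radius_partial_r /= xi_bF sqr_radius_sqn /sqn.
Qed.

Lemma source_sqrE s x : 2 < s -> s0 <= s <= s1 ->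
  (source chi T s u (slice T s x)) ^+ 2 = source_sqr chi u s x.
Proof.
move=> s2 sI; rewrite sliceE // /source /source_sqr /= (jacE cchi Ttime) ?radius_ge0 //.
rewrite sqr_radius_sqn sqr_quotient.
have zE : zeta chi s (radius x) ^+ 2 = 1 - bF chi s x ^+ 2 * sqn x.
  have -> : zeta chi s (radius x) = Num.sqrt (1 - bF chi s x ^+ 2 * sqn x).
    have h : Num.sqrt (s ^+ 2 + radius x ^+ 2) ^+ 2 = s ^+ 2 + radius x ^+ 2.
      by rewrite sqr_sqrtr // addr_ge0 ?sqr_ge0.
    by rewrite /zeta -xi_bF expr_div_n h sqr_radius_sqn [in RHS]mulrAC.
  by rewrite sqr_sqrtr // ltW // (zeta2_gt0 cchi s0_ge2 x sI).
have AE : coefA chi s (tF chi s x) (radius x) = coefA_slice chi s x.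
  rewrite /coefA /coefA_slice -[2 * bF chi s x]mulrC -xi_bF -sqr_radius sqr_radius_sqn.
  by ring.
rewrite zE AE sqr_sqrtr; last exact: (ltW (coefA_slice_gt0 cchi s0_ge2 x sI)).
by rewrite /coefA_slice /on_slice /jF /box.
Qed.

Variable U : set (spacetime R).
Hypothesis oU : open U.
Hypothesis slabU : slab T s0 s1 `<=` U.
Hypothesis Cu : C2_on U u.
Hypothesis u_decay : decays 10 (slab T s0 s1) u.

Let slU s x : s0 <= s <= s1 -> U (sl chi s x).
Proof. by move=> sI; exact/slabU/sl_slab. Qed.

Let slice_decay : exists C0 : R, forall s x, s0 <= s <= s1 ->
  [/\ `|u (sl chi s x)| <= C0 * japanese x ^- 10,
      forall i, `|partial i u (sl chi s x)| <= C0 * japanese x ^- 10 &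
      forall i j, `|partial j (partial i u) (sl chi s x)| <= C0 * japanese x ^- 10].
Proof.
by case: u_decay => C0 CP; exists C0 => s x sI; exact: (CP _ (sl_slab x sI)).
Qed.

Lemma EconE s : s0 <= s <= s1 -> Econ chi T s u = (energy chi u s)%:E.
Proof.
move=> sI; have [C0 C0P] := slice_decay.
rewrite /energy (EFin_slice_integral s01 (tame_energy_density cchi s0_ge2 s01 slU Cu C0P) sI).
by apply: eq_integral => x _; rewrite econE.
Qed.

Lemma L2sliceE s : 2 < s -> s0 <= s <= s1 ->
  L2slice T s (source chi T s u) = (Num.sqrt (source_norm2 chi u s))%:E.
Proof.
move=> s2 sI; have [C0 C0P] := slice_decay.
rewrite /L2slice unlock /=.
have -> : (\int[leb2]_x `|(EFin \o source chi T s u \o slice T s) x| `^ 2 =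
    (source_norm2 chi u s)%:E)%E.
  rewrite (EFin_slice_integral s01 (tame_energy_source_sqr cchi s0_ge2 s01 slU Cu C0P) sI).
  apply: eq_integral => x _ /=.
  congr (_%:E).
  exact: etrans (sqr_norm_powR _) (source_sqrE x s2 sI).
have n0 := source_norm2_ge0 cchi s0_ge2 u sI.
by rewrite poweR12_sqrt // lee_fin.
Qed.

Lemma Econ_ge0 s : s0 <= s <= s1 -> (0 <= Econ chi T s u)%E.
Proof.
move=> sI; have [C0 C0P] := slice_decay.
by rewrite EconE // lee_fin (energy_ge0 cchi s0_ge2 s01 oU slU Cu C0P sI).
Qed.

Lemma energy_estimate_lt : s0 < s1 ->
  (sqrte (Econ chi T s1 u) <= sqrte (Econ chi T s0 u) + (Num.sqrt 2 / 2)%:E *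
     \int[leb]_(tau in `[s0, s1]) L2slice T tau (source chi T tau u))%E.
Proof.
move=> lt01; have [C0 C0P] := slice_decay.
rewrite !EconE ?lexx ?s01 //.
pose N := source_norm2 chi u.
have cN : {within `[s0, s1], continuous N}.
  exact: (source_norm2_continuous cchi s0_ge2 s01 slU Cu C0P).
have iN := sqrt_norm_integrable cN.
have mN : measurable_fun `[s0, s1] (EFin \o (fun s => Num.sqrt (N s))).
  by case/integrableP : iN.
have mN' : measurable_fun `]s0, s1] (fun s => (Num.sqrt (N s))%:E).
  by apply: measurable_funS mN => //; exact: subset_itv_oc_cc.
have E1 : {in `]s0, s1]%classic, (fun s => L2slice T s (source chi T s u)) =1
    (fun s => (Num.sqrt (N s))%:E)}.
  move=> s; rewrite inE /= in_itv /= => /andP[a b].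
  by apply: L2sliceE; [exact: le_lt_trans a|rewrite (ltW a)].
have -> : (\int[leb]_(tau in `[s0, s1]) L2slice T tau (source chi T tau u) =
    (\int[leb]_(tau in `[s0, s1]%classic) Num.sqrt (N tau))%:E)%E.
  rewrite /Rintegral fineK; last exact: integrable_fin_num iN.
  (* Drops the endpoint s0, at which [jac] is undetermined when s0 = 2. *)
  rewrite -integral_itv_obnd_cbnd; last first.
    by apply: eq_measurable_fun mN' => s sI; rewrite E1.
  rewrite -[RHS]integral_itv_obnd_cbnd //.
  by apply: eq_integral => s sI; exact: E1.
rewrite -EFinM -EFinD lee_fin.
apply: (sqrt_growth lt01 (G := slice_integral (energy_source chi u))) => //.
- by move=> s; exact: (is_derive_energy cchi s0_ge2 s01 oU slU Cu C0P).
- exact: (energy_continuous cchi s0_ge2 s01 slU Cu C0P).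
- by move=> s; exact: (energy_ge0 cchi s0_ge2 s01 oU slU Cu C0P).
- by move=> s; exact: (source_norm2_ge0 cchi s0_ge2 u).
- by move=> s l; exact: (energy_source_bound cchi s0_ge2 s01 oU slU Cu C0P).
Qed.

(** The growth argument needs a nondegenerate interval; for s0 = s1 only the nonnegativity of the
    integral is left to check. *)
Lemma energy_estimate :
  (sqrte (Econ chi T s1 u) <= sqrte (Econ chi T s0 u) + (Num.sqrt 2 / 2)%:E *
     \int[leb]_(tau in `[s0, s1]) L2slice T tau (source chi T tau u))%E.
Proof.
have := s01; rewrite le_eqVlt => /predU1P[<-|]; last exact: energy_estimate_lt.
rewrite leeDl // mule_ge0 //.
by apply: integral_ge0 => s _; exact: Lnorm_ge0.
Qed.

End conclusion.

(** The two nonnegativity claims give the square roots their usual meaning, since [sqrte] sends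
    negative values to 0. *)
Theorem proposition11p2 (R : realType) :
  exists m : nat,
  forall (chi : R -> R) (T : R -> R -> R) (s0 s1 : R) (u : spacetime R -> R),
    cutoff chi -> time_function chi T ->
    2 <= s0 -> s0 <= s1 ->
    C2_around (slab T s0 s1) u -> decays m (slab T s0 s1) u ->
    [/\ (0 <= Econ chi T s0 u)%E,
        (0 <= Econ chi T s1 u)%E &
        (sqrte (Econ chi T s1 u) <=
         sqrte (Econ chi T s0 u)
         + (Num.sqrt 2 / 2)%:E *
           \int[lebesgue_measure]_(tau in `[s0, s1])
             L2slice T tau (source chi T tau u))%E].
Proof.
exists 10%N => chi T s0 s1 u cchi Ttime s2 s01 [U [oU slabU Cu]] du.
have ge0 := Econ_ge0 cchi Ttime s2 s01 oU slabU Cu du.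
split; [apply: ge0; rewrite lexx // | apply: ge0; rewrite s01 lexx // |].
exact: (energy_estimate cchi Ttime s2 s01 oU slabU Cu du).
Qed.
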